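(* There is a randomized comparison-based algorithm that, given an unsorted set $X$ of $n$ distinct elements and an integer $1\le k\le n$, returns the $k$-th smallest element $x_k$ of $X$, such that the expected number of comparisons in which $x_k$ participates is $O(\log\log k)$.
   Context: A comparison-based algorithm accesses the input only through pairwise comparisons; an element participates in a comparison if it is one of the two elements compared. The expectation is over the algorithm's internal randomness, for any fixed input. *)

(* Defs.v *)
From Stdlib Require Import Reals.
From mathcomp Require Import all_boot all_order.
Set Implicit Arguments. Unset Strict Implicit. Unset Printing Implicit Defensive.

(** * A model of randomized comparison-based algorithms on n input positions.

  The input is a sequence [x : 'I_n -> T] of distinct keys from a totally
  ordered type.  The algorithm never sees the keys: at each step, depending on
  the history of all answers received so far, it either
  - compares the elements at two positions ([Cmp i j], answer 1 iff x i < x j),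
  - draws a uniformly random number in {0,...,m} ([Rand m]), or
  - returns a position ([Ret i]) and stops. *)
Inductive action (n : nat) : Type :=
| Cmp of 'I_n & 'I_n
| Rand of nat
| Ret of 'I_n.

Arguments Cmp {n}. Arguments Rand {n}. Arguments Ret {n}.

(** A (possibly non-terminating) randomized comparison algorithm: next action
   as a function of the history (sequence of answers / random draws). *)
Definition algorithm (n : nat) := seq nat -> action n.

Definition cmp_oracle (d : Order.disp_t) (T : orderType d) (n : nat)
  (x : 'I_n -> T) (i j : 'I_n) : nat := nat_of_bool (Order.lt (x i) (x j)).

(** Expected number of comparisons in which position [t] participates, during
   the first [fuel] steps of the run started from history [h]. The true
   expectation is the supremum over [fuel] (the sequence is nondecreasing). *)
Fixpoint exp_part_cost (n : nat) (A : algorithm n) (ans : 'I_n -> 'I_n -> nat)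
  (t : 'I_n) (fuel : nat) (h : seq nat) : R :=
  match fuel with
  | O => R0
  | S f =>
    match A h with
    | Cmp i j => Rplus (if (i == t) || (j == t) then R1 else R0)
                       (exp_part_cost A ans t f (rcons h (ans i j)))
    | Rand m => Rmult (Rinv (INR m.+1))
                      (sum_f_R0 (fun r => exp_part_cost A ans t f (rcons h r)) m)
    | Ret _ => R0
    end
  end.

Fixpoint prob_returns (n : nat) (A : algorithm n) (ans : 'I_n -> 'I_n -> nat)
  (t : 'I_n) (fuel : nat) (h : seq nat) : R :=
  match fuel with
  | O => R0
  | S f =>
    match A h with
    | Cmp i j => prob_returns A ans t f (rcons h (ans i j))
    | Rand m => Rmult (Rinv (INR m.+1))
                      (sum_f_R0 (fun r => prob_returns A ans t f (rcons h r)) m)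
    | Ret i => if i == t then R1 else R0
    end
  end.

Definition is_kth (d : Order.disp_t) (T : orderType d) (n : nat)
  (x : 'I_n -> T) (k : nat) (t : 'I_n) : Prop :=
  #|[pred j : 'I_n | Order.lt (x j) (x t)]| = k.-1.

(* Main.v *)
Require Import Defs.
From Stdlib Require Import Reals.
From mathcomp Require Import all_boot all_order.
From mathcomp Require Import all_algebra.
From mathcomp Require Import zify ring lra.
From mathcomp Require Import Rstruct.
Set Implicit Arguments. Unset Strict Implicit. Unset Printing Implicit Defensive.
Import Order.TTheory GRing.Theory Num.Theory.

(* The algorithm works in two phases, and only comparisons involving x_k are
   counted.

   Phase 1 discards all but O(k) elements.  The elements are treated in random
   order, keeping the set B of the elements smaller than a pivot p of rank at
   least k among those treated; a new element is compared only with p.  At step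
   m, with probability about 4/m, a uniformly random element of B is tried as a
   new pivot, which costs x_k at most 2 comparisons on average.  The m-th random
   element is x_k with probability 1/m, so the mean cost c_m satisfies
   m c_m <= (m - 1) c_(m-1) + 9, hence c_m <= 9; and E|B| <= 4k + 1.

   Phase 2 searches for the element of rank r in a set of b elements.  With
   m ~ b^(1/6), it sorts a sample of m^3 elements and chooses as right pivot the
   sample element whose position in the sample is uniform in a window of width
   m^2 lying m^2 beyond the expected position of x_k, and symmetrically a left
   pivot.  Chebyshev's inequality shows that x_k is a given pivot with
   probability at most 1/b, so comparing all elements with the pivots costs O(1)
   on average, and that on average O(b^(5/6)) elements remain on the side of
   x_k.  By Jensen's inequality each round decreases the mean of ln ln b by a
   constant, so there are O(log log b) rounds on average. *)

Local Open Scope ring_scope.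

(** * Programs with random draws *)

(** Programs are trees, so that they can be analysed by structural induction; only the branches
    [r <= m] of [Draw m] can occur. *)
Inductive prog (n : nat) (a : Type) : Type :=
| Done of a
| Ask of 'I_n & 'I_n & (bool -> prog n a)
| Draw of nat & (nat -> prog n a).

Arguments Done {n a}. Arguments Ask {n a}. Arguments Draw {n a}.

Fixpoint bind n (a b : Type) (p : prog n a) (c : a -> prog n b) : prog n b :=
  match p with
  | Done v => c v
  | Ask i j q => Ask i j (fun z => bind (q z) c)
  | Draw m q => Draw m (fun r => bind (q r) c)
  end.

(** An empty list yields the default [d], so the rules below for its outcome ask for a nonempty
    one. *)
Definition uniform n (a : Type) (d : a) (l : seq a) : prog n a :=
  Draw (size l).-1 (fun r => Done (nth d l r)).

Arguments uniform {n a}.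

(** The result keeps the pairs whose first element was found smaller; later decisions are read off
    this list. *)
Fixpoint compares n (l : seq ('I_n * 'I_n)) : prog n (seq ('I_n * 'I_n)) :=
  if l is q :: l' then
    Ask q.1 q.2 (fun z => bind (compares l')
                   (fun s => Done (if z then q :: s else s)))
  else Done [::].

(** The history is replayed from the root of the tree, each entry selecting a branch; this turns a
    program into a function of the history. *)
Fixpoint run n (p : prog n 'I_n) (h : seq nat) : action n :=
  match p, h with
  | Done v, _ => Ret v
  | Ask i j q, z :: h' => run (q (z != 0%N)) h'
  | Ask i j q, [::] => Cmp i j
  | Draw m q, r :: h' => run (q r) h'
  | Draw m q, [::] => Rand m
  end.

Fixpoint depth n (a : Type) (p : prog n a) : nat :=
  match p with
  | Done _ => 1
  | Ask i j q => (maxn (depth (q true)) (depth (q false))).+1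
  | Draw m q => (\max_(r < m.+1) depth (q r)).+1
  end.

(** * Sure outcomes, expectation and expected cost of a program *)

Section Semantics.
Variables (K : realFieldType) (n : nat) (lt : rel 'I_n).
Implicit Types (t : 'I_n).

Fixpoint supp (a : Type) (p : prog n a) (P : a -> Prop) : Prop :=
  match p with
  | Done v => P v
  | Ask i j q => supp (q (lt i j)) P
  | Draw m q => forall r, (r <= m)%N -> supp (q r) P
  end.

Fixpoint ex (a : Type) (p : prog n a) (F : a -> K) : K :=
  match p with
  | Done v => F v
  | Ask i j q => ex (q (lt i j)) F
  | Draw m q => m.+1%:R^-1 * \sum_(r < m.+1) ex (q r) F
  end.

Fixpoint cost (a : Type) t (p : prog n a) : K :=
  match p with
  | Done v => 0
  | Ask i j q => ((i == t) || (j == t))%:R + cost t (q (lt i j))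
  | Draw m q => m.+1%:R^-1 * \sum_(r < m.+1) cost t (q r)
  end.

Lemma supp_impl (a : Type) (p : prog n a) (P Q : a -> Prop) :
  supp p P -> (forall v, P v -> Q v) -> supp p Q.
Proof.
move=> + PQ; elim: p => [v|i j q IH|m q IH] /=; [exact: PQ|exact: IH|].
by move=> H r rm; apply/IH/H.
Qed.

Lemma supp_true (a : Type) (p : prog n a) (P : a -> Prop) :
  (forall v, P v) -> supp p P.
Proof. by move=> HP; elim: p => [v|i j q IH|m q IH] //=. Qed.

Lemma supp_bind (a b : Type) (p : prog n a) (c : a -> prog n b) P :
  supp p (fun v => supp (c v) P) -> supp (bind p c) P.
Proof.
elim: p => [v|i j q IH|m q IH] //=; first exact: IH.
by move=> H r rm; apply/IH/H.
Qed.

Lemma ex_bind (a b : Type) (p : prog n a) (c : a -> prog n b) (F : b -> K) :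
  ex (bind p c) F = ex p (fun v => ex (c v) F).
Proof.
by elim: p => [v|i j q IH|m q IH] //=; congr (_ * _); apply: eq_bigr => r _.
Qed.

Lemma cost_bind (a b : Type) t (p : prog n a) (c : a -> prog n b) :
  cost t (bind p c) = cost t p + ex p (fun v => cost t (c v)).
Proof.
elim: p => [v|i j q IH|m q IH] /=; first by rewrite add0r.
  by rewrite IH addrA.
by rewrite -mulrDr -big_split; congr (_ * _); apply: eq_bigr => r _; rewrite IH.
Qed.

Lemma ex_le (a : Type) (p : prog n a) (F G : a -> K) :
  supp p (fun v => F v <= G v) -> ex p F <= ex p G.
Proof.
elim: p => [v|i j q IH|m q IH] //= H; first exact: IH.
rewrite ler_wpM2l ?invr_ge0 //; apply: ler_sum => r _.
by apply/IH/H; rewrite -ltnS.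
Qed.

Lemma ex_eq (a : Type) (p : prog n a) (F G : a -> K) :
  supp p (fun v => F v = G v) -> ex p F = ex p G.
Proof.
by move=> H; apply/le_anti/andP; split; apply/ex_le/(supp_impl H) => v ->.
Qed.

Lemma ex_const (a : Type) (p : prog n a) c : ex p (fun=> c) = c.
Proof.
elim: p => [v|i j q IH|m q IH] //=; under eq_bigr do rewrite IH.
by rewrite sumr_const card_ord -[c *+ _]mulr_natl mulrA mulVf ?mul1r // pnatr_eq0.
Qed.

Lemma exD (a : Type) (p : prog n a) F G :
  ex p (fun v => F v + G v) = ex p F + ex p G.
Proof.
elim: p => [v|i j q IH|m q IH] //=; under eq_bigr do rewrite IH.
by rewrite big_split mulrDr.
Qed.

Lemma exZ (a : Type) (p : prog n a) c F :
  ex p (fun v => c * F v) = c * ex p F.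
Proof.
elim: p => [v|i j q IH|m q IH] //=; under eq_bigr do rewrite IH.
by rewrite -mulr_sumr mulrCA.
Qed.

Lemma ex_sum (a I : Type) (p : prog n a) (l : seq I) (P : pred I) (F : I -> a -> K) :
  ex p (fun v => \sum_(i <- l | P i) F i v) = \sum_(i <- l | P i) ex p (F i).
Proof.
elim: l => [|i l IH].
  by rewrite big_nil -[RHS](ex_const p); apply/ex_eq/supp_true => v; rewrite big_nil.
rewrite big_cons -IH; case: ifP => Pi; rewrite -?exD;
  by apply/ex_eq/supp_true => v; rewrite big_cons Pi.
Qed.

Lemma cost_ge0 (a : Type) (p : prog n a) t : 0 <= cost t p.
Proof.
elim: p => [v|i j q IH|m q IH] //=; first by rewrite addr_ge0.
by rewrite mulr_ge0 ?invr_ge0 ?sumr_ge0.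
Qed.

Lemma ex_val (a : Type) (p : prog n a) v F : supp p (eq v) -> ex p F = F v.
Proof.
by move=> H; rewrite -(ex_const p (F v)); apply/ex_eq/(supp_impl H) => ? <-.
Qed.

Lemma ex_draw (a : Type) (d : a) (l : seq a) F : (0 < size l)%N ->
  ex (uniform d l) F = (size l)%:R^-1 * \sum_(v <- l) F v.
Proof.
by move=> l0; rewrite /= prednK // (big_nth d) big_mkord.
Qed.

Lemma supp_draw (a : eqType) (d : a) (l : seq a) (P : a -> Prop) :
  (0 < size l)%N -> {in l, forall v, P v} -> supp (uniform d l) P.
Proof.
by move=> l0 lP r rl; apply/lP/mem_nth; rewrite -(prednK l0) ltnS.
Qed.

Lemma cost_draw (a : Type) (d : a) (l : seq a) t : cost t (uniform d l) = 0.
Proof. by rewrite /= big1 ?mulr0. Qed.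

Lemma supp_compares (l : seq ('I_n * 'I_n)) :
  supp (compares l) (eq [seq q <- l | lt q.1 q.2]).
Proof.
elim: l => [|q l IH] //=; apply: supp_bind.
by apply: supp_impl IH _ => s <-.
Qed.

Lemma cost_compares (l : seq ('I_n * 'I_n)) t :
  cost t (compares l) = (count (fun q => (q.1 == t) || (q.2 == t)) l)%:R.
Proof.
elim: l => [|q l IH] //=; rewrite cost_bind ex_const addr0 IH.
by rewrite natrD.
Qed.

End Semantics.

Arguments cost {K n} lt {a} t p.
Arguments ex {K n} lt {a} p F.

(** The history is general for the induction: after [h], [A] behaves like the subtree [p]. Cutting
    the run off at [fuel] only drops nonnegative terms. *)
Lemma run_cost n (lt : rel 'I_n) (ans : 'I_n -> 'I_n -> nat) t (A : algorithm n) p fuel h :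
    (forall i j, ans i j = lt i j) -> (forall h', A (h ++ h') = run p h') ->
  exp_part_cost A ans t fuel h <= cost lt t p.
Proof.
move=> anslt; elim: fuel h p => [|f IH] h p Ap /=.
  exact: cost_ge0.
have:= Ap [::]; rewrite cats0 => ->.
case: p Ap => [v|i j q|m q] Ap //=.
  apply: lerD; first by case: ifP.
  by apply: IH => h'; rewrite cat_rcons Ap /= anslt eqb0 negbK.
rewrite -/(INR m.+1) RmultE INRE RinvE sum_f_R0E big_mkord ler_wpM2l ?invr_ge0 //.
by apply: ler_sum => r _; apply: IH => h'; rewrite cat_rcons Ap.
Qed.

(** The tree has finite depth, so this much fuel completes every branch, and each leaf that can be
    reached carries [t]. *)
Lemma run_returns n (lt : rel 'I_n) (ans : 'I_n -> 'I_n -> nat) t (A : algorithm n) p fuel h :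
    (forall i j, ans i j = lt i j) -> (forall h', A (h ++ h') = run p h') -> (depth p <= fuel)%N ->
    supp lt p (eq t) ->
  prob_returns A ans t fuel h = 1.
Proof.
move=> anslt; elim: fuel h p => [|f IH] h p Ap; first by case: p Ap.
move=> pf Hs /=; have:= Ap [::]; rewrite cats0 => ->.
case: p Ap pf Hs => [v|i j q|m q] Ap /=.
- by move=> _ ->; rewrite eqxx.
- rewrite ltnS geq_max => /andP[d1 d2] Hs.
  apply: IH Hs => [h'|]; first by rewrite cat_rcons Ap /= anslt eqb0 negbK.
  by case: (lt i j).
rewrite ltnS => /bigmax_leqP dm Hs.
rewrite -/(INR m.+1) RmultE INRE RinvE sum_f_R0E big_mkord (eq_bigr (fun=> 1)) => [|r _].
  by rewrite sumr_const card_ord mulVf // pnatr_eq0.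
apply: (IH _ (q r)) => [h'||]; first by rewrite cat_rcons Ap.
  exact: dm.
by apply: Hs; rewrite -ltnS.
Qed.

(** * Random samples *)

Section SampleMoments.
Variables (K : realFieldType) (T : finType) (s : nat) (B : {set T}).

(** This is the independence of the coordinates of a uniform sample with repetition. *)
Lemma sum_sample_prod (F : 'I_s -> T -> K) :
  \sum_(f : {ffun 'I_s -> T} | f \in ffun_on (mem B)) \prod_i F i (f i)
    = \prod_i \sum_(u in B) F i u.
Proof. by rewrite bigA_distr_big. Qed.

Lemma prod_coord (h : T -> K) (i : 'I_s) (f : 'I_s -> T) :
  \prod_l (if l == i then h (f l) else 1) = h (f i).
Proof. by rewrite -big_mkcond big_pred1_eq. Qed.

Lemma sum_sample_const :
  \sum_(f : {ffun 'I_s -> T} | f \in ffun_on (mem B)) 1 = #|B|%:R ^+ s :> K.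
Proof. by rewrite sumr_const card_ffun_on card_ord natrX. Qed.

Lemma sum_sample_coord (h : T -> K) (i : 'I_s) :
  #|B|%:R * (\sum_(f : {ffun 'I_s -> T} | f \in ffun_on (mem B)) h (f i))
    = #|B|%:R ^+ s * \sum_(u in B) h u.
Proof.
rewrite (eq_bigr (fun f : {ffun 'I_s -> T} =>
   \prod_l (if l == i then h (f l) else 1))) => [|f _]; last first.
  by rewrite prod_coord.
rewrite (sum_sample_prod (fun l u => if l == i then h u else 1)).
rewrite (bigD1 i) //= eqxx mulrCA mulrC; congr (_ * _).
rewrite (eq_bigr (fun=> #|B|%:R)) => [|l /negPf->]; last first.
  by rewrite sumr_const.
rewrite prodr_const -exprS; congr (_ ^+ _).
by rewrite cardC1 card_ord prednK // (leq_trans _ (ltn_ord i)).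
Qed.

(* Expanding the square, the terms with two distinct indices vanish, because
   one of the two indices differs from [i0] and [g] has mean zero. *)
Lemma sample_second_moment (h g : T -> K) (i0 : 'I_s) :
    (forall u, 0 <= h u) -> (forall u, g u ^+ 2 <= 1) ->
    \sum_(u in B) g u = 0 ->
  \sum_(f : {ffun 'I_s -> T} | f \in ffun_on (mem B)) h (f i0) * (\sum_i g (f i)) ^+ 2
    <= s%:R * \sum_(f : {ffun 'I_s -> T} | f \in ffun_on (mem B)) h (f i0).
Proof.
move=> h0 g1 gB.
have cross i j : i != j ->
    \sum_(f : {ffun 'I_s -> T} | f \in ffun_on (mem B)) h (f i0) * (g (f i) * g (f j)) = 0.
  move=> ij; rewrite (eq_bigr (fun f : {ffun 'I_s -> T} => \prod_l
     ((if l == i0 then h (f l) else 1) * ((if l == i then g (f l) else 1) *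
      (if l == j then g (f l) else 1))))) => [|f _]; last first.
    by rewrite !big_split /= !prod_coord.
  rewrite (sum_sample_prod (fun l u => (if l == i0 then h u else 1) *
     ((if l == i then g u else 1) * (if l == j then g u else 1)))).
  have zero l : l != i0 -> (l == i) (+) (l == j) -> \sum_(u in B)
      (if l == i0 then h u else 1) *
      ((if l == i then g u else 1) * (if l == j then g u else 1)) = 0.
    move=> /negPf-> lij; rewrite -[RHS]gB; apply: eq_bigr => u _.
    by rewrite mul1r; case: (l == i) (l == j) lij => [] [] //; rewrite ?mulr1 ?mul1r.
  have [ii0|ii0] := eqVneq i i0.
    rewrite (bigD1 j) //= zero ?mul0r //; first by rewrite -ii0 eq_sym.
    by rewrite eqxx eq_sym (negPf ij).
  by rewrite (bigD1 i) //= zero ?mul0r // eqxx (negPf ij).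
rewrite (eq_bigr (fun f : {ffun 'I_s -> T} =>
   \sum_i \sum_j h (f i0) * (g (f i) * g (f j)))) => [|f _]; last first.
  rewrite expr2 mulr_suml mulr_sumr; apply: eq_bigr => i _.
  by rewrite !mulr_sumr.
have -> (H : K) : s%:R * H = \sum_(i < s) H by rewrite sumr_const card_ord mulr_natl.
rewrite exchange_big /=.
apply: ler_sum => i _; rewrite exchange_big /= (bigD1 i) //= [X in _ + X]big1 ?addr0 => [|j].
  by apply: ler_sum => f _; rewrite -expr2 ler_piMr.
by rewrite eq_sym => /cross.
Qed.

End SampleMoments.

(** * Order statistics of a sample and the elements they separate *)

Section Pivot.
Variables (T : finType) (s : nat).
Implicit Types (lt : rel T) (f : {ffun 'I_s -> T}).

Definition rank lt (B : {set T}) y := #|[set u in B | lt u y]|.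
Definition nlt lt f y := #|[set i | lt (f i) y]|.
Definition nle lt f y := #|[set i | lt (f i) y || (f i == y)]|.
(** The entry at position [j], counted from 0, of the sorted sample: with repetitions, [p] fills the
    positions from [nlt] to [nle - 1]. It is [None] past the end of the sample. *)
Definition pivot lt f (j : nat) : option T :=
  [pick p in [set f i | i : 'I_s] | (nlt lt f p <= j < nle lt f p)%N].
(** [y] remains a candidate after partitioning around [p] in a search for [t]; if [p = t], no other
    candidate remains. *)
Definition same_side lt t p y := [&& p != t, y != p & lt y p == lt t p].

(** Comparisons inside the sample determine the pivot, so the algorithm can compute it from their
    recorded answers. *)
Lemma eq_pivot (o lt : rel T) f j :
    {in [set f i | i : 'I_s] &, o =2 lt} -> pivot o f j = pivot lt f j.
Proof.
move=> olt; apply: eq_pick => p /=; case: imsetP => //= pf.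
have -> : nlt o f p = nlt lt f p.
  by apply: eq_card => i; rewrite !inE olt ?imset_f //; case: pf => x _ ->; rewrite imset_f.
have -> // : nle o f p = nle lt f p.
by apply: eq_card => i; rewrite !inE olt ?imset_f //; case: pf => x _ ->; rewrite imset_f.
Qed.

Variables (key : T -> nat).
Hypothesis key_inj : injective key.
Notation lt := (relpre key ltn).

(** The pivot is the least sample element [p] with [j < nle lt f p]; the count at [y] shows that one
    exists not above [y]. *)
Lemma nle_below f y j : (j < nle lt f y)%N ->
  exists2 p, (key p <= key y)%N & pivot lt f j = Some p.
Proof.
(* [z] may be replaced by the largest sample element not above it, which has the same sample
   elements up to it. *)
have nleP z : (j < nle lt f z)%N ->
    exists i, (key (f i) <= key z)%N /\ (j < nle lt f (f i))%N.
  move=> jz; have /card_gt0P[i0] : (0 < nle lt f z)%N by apply: leq_trans jz.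
  rewrite inE => i0z.
  case: (@arg_maxnP _ i0 (fun l => lt (f l) z || (f l == z)) (fun i => key (f i)) i0z) => i iz imax; exists i; split.
    by case/orP: iz => [/ltnW|/eqP->].
  apply: leq_trans jz _; apply/subset_leq_card/subsetP => l.
  by rewrite !inE => /imax /=; rewrite leq_eqVlt orbC => /orP[->//|/eqP/key_inj->]; rewrite eqxx orbT.
case/nleP => i0 [i0y ji0].
case: (@arg_minnP _ i0 (fun i => j < nle lt f (f i))%N (fun i => key (f i)) ji0) => i ji imin.
rewrite /pivot; case: pickP => [p /andP[/imsetP[l _ ->]] /andP[jl1 jl2]|/(_ (f i))].
  exists (f l) => //; rewrite leqNgt; apply/negP => yl.
  have: (nle lt f (f i0) <= nlt lt f (f l))%N.
    apply/subset_leq_card/subsetP => l'; rewrite !inE /= => /orP[l'i|/eqP->].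
      exact: ltn_trans l'i (leq_ltn_trans i0y yl).
    exact: leq_ltn_trans i0y yl.
  by move=> H; have := leq_ltn_trans (leq_trans H jl1) ji0; rewrite ltnn.
rewrite imset_f //= ji andbT leqNgt => /negbT/negPn jlt.
(* If more than [j] sample entries were below [f i], the largest of them would contradict the
   minimality of [f i]. *)
suff [l [li jl]] : exists l, (key (f l) < key (f i))%N /\ (j < nle lt f (f l))%N.
  by have := imin l jl; rewrite leqNgt li.
have /card_gt0P[i1] : (0 < nlt lt f (f i))%N by apply: leq_trans jlt.
rewrite inE => i1i.
case: (@arg_maxnP _ i1 (fun l => lt (f l) (f i)) (fun i => key (f i)) i1i) => l li lmax; exists l; split=> //.
apply: leq_trans jlt _; apply/subset_leq_card/subsetP => l'.
by rewrite !inE => /lmax /=; rewrite leq_eqVlt orbC => /orP[->//|/eqP/key_inj->]; rewrite eqxx orbT.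
Qed.

Lemma pivot_bounds f j p : pivot lt f j = Some p -> (nlt lt f p <= j < nle lt f p)%N.
Proof. by rewrite /pivot; case: pickP => // x /andP[_ H] [<-]. Qed.

(** If [nle] is at most [j] at [t] and above [j] at [y], the pivot lies above [t] and not above [y],
    so it removes [y]. *)
Lemma pivot_side f j t y : (key t < key y)%N ->
    (forall p, pivot lt f j = Some p -> same_side lt t p y) ->
  (j < nle lt f t)%N || (nle lt f y <= j)%N.
Proof.
move=> ty Hp; rewrite -implyNb -leqNgt; apply/implyP => tj.
rewrite leqNgt; apply/negP => jy.
have [p py pj] := nle_below jy; have /and3P[pt yp /eqP /= sp] := Hp _ pj.
have py' : (key p < key y)%N.
  by rewrite ltn_neqAle py andbT; apply: contraNneq yp => /key_inj->.
have pt' : (key p < key t)%N.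
  rewrite ltn_neqAle leqNgt -sp -leqNgt py andbT.
  by apply: contraNneq pt => /key_inj->.
have [_ jp] := andP (pivot_bounds pj).
have : (nle lt f p <= nle lt f t)%N.
  apply/subset_leq_card/subsetP => i; rewrite !inE /=.
  by case/orP => [ip|/eqP->]; rewrite ?(ltn_trans ip pt') ?pt'.
by move: jp tj; lia.
Qed.

End Pivot.

Lemma eq_imp_le (K : numDomainType) (x y : K) : x = y -> x <= y.
Proof. by move->. Qed.

(** The quotient approximates the number of sample entries below an element of rank [r], [m ^ 2] is
    the safety margin and [o] the random offset. The 2 leaves room for the floor and for counting
    the element itself. *)
Definition target_index (b m r o : nat) := ((m ^ 3 * r) %/ b + m ^ 2 + 2 + o)%N.

(** * Chebyshev bounds for the random pivot *)

Section PivotMoments.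
Variables (K : realFieldType) (T : finType) (key : T -> nat).
Hypothesis key_inj : injective key.
Notation lt := (relpre key ltn).
Variables (B : {set T}) (m : nat) (t : T).
Hypotheses (m_gt0 : (0 < m)%N) (tB : t \in B).
Implicit Types (f : {ffun 'I_(m ^ 3) -> T}) (y : T).

Let b := #|B|.
Let r := rank lt B t.
Let J o := target_index b m r o.
Let sample := [pred f : {ffun 'I_(m ^ 3) -> T} | f \in ffun_on (mem B)].

Let b_gt0 : (0 < b)%N. Proof. by apply/card_gt0P; exists t. Qed.

(** The deviation from its mean of the number of sample entries up to [y]; [y] counts itself, hence
    the successor of the rank. *)
Definition dev y f : K :=
  (nle lt f y)%:R - (m ^ 3)%:R * ((rank lt B y).+1%:R / #|B|%:R).

Lemma card_le_rank y : y \in B -> #|[set u in B | lt u y || (u == y)]| = (rank lt B y).+1.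
Proof.
move=> yB; rewrite (cardsD1 y) !inE yB eqxx orbT add1n; congr _.+1.
apply: eq_card => u; rewrite !inE; case: eqVneq => [->|] /=.
  by rewrite ltnn andbF.
by rewrite orbF.
Qed.

(** The count is a sum of [m ^ 3] independent indicators. The weight is 1 for plain variances and
    the indicator of [f i0 = t] when bounding how often the pivot is [t]. *)
Lemma dev_second_moment (h : T -> K) i0 y : y \in B -> (forall u, 0 <= h u) ->
  \sum_(f | sample f) h (f i0) * dev y f ^+ 2 <= (m ^ 3)%:R * \sum_(f | sample f) h (f i0).
Proof.
move=> yB h0; set q : K := (rank lt B y).+1%:R / b%:R.
have b0 : b%:R != 0 :> K by rewrite pnatr_eq0 -lt0n.
have q01 : 0 <= q <= 1.
  rewrite divr_ge0 //= ler_pdivrMr ?mul1r ?ltr0n // ler_nat -card_le_rank //.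
  by apply/subset_leq_card/subsetP => u; rewrite inE => /andP[].
pose g u : K := (lt u y || (u == y))%:R - q.
rewrite (eq_bigr (fun f => h (f i0) * (\sum_i g (f i)) ^+ 2)) => [|f _]; last first.
  congr (_ * _ ^+ 2); rewrite big_split /= sumr_const card_ord mulNrn -[_ *+ (m ^ 3)]mulr_natl.
  congr (_ - _); rewrite /nle -sum1_card natr_sum big_mkcond /=.
  by apply: eq_bigr => i _; rewrite inE; case: (_ || _).
apply: sample_second_moment => // [u|].
  by rewrite /g; case: (_ || _); move: q01 => /andP[q0 q1] /=; rewrite expr2; nra.
rewrite big_split /= sumr_const mulNrn -[_ *+ #|_|]mulr_natl mulrCA divff // mulr1.
apply/eqP; rewrite subr_eq0 -card_le_rank // -sum1_card natr_sum [eqbLHS]big_mkcond [eqbRHS]big_mkcond.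
by apply/eqP/eq_bigr => u _; rewrite inE; case: (u \in B) => //=; case: (_ || _).
Qed.

Let quo := ((m ^ 3 * r) %/ b)%N.
Let quo_le : quo%:R <= (m ^ 3)%:R * (r%:R / b%:R) :> K.
Proof. by rewrite mulrA ler_pdivlMr ?ltr0n // -!natrM ler_nat leq_divM. Qed.
Let quo_gt : (m ^ 3)%:R * (r%:R / b%:R) < quo%:R + 1 :> K.
Proof. by rewrite mulrA ltr_pdivrMr ?ltr0n // natr1 -!natrM ltr_nat ltn_ceil. Qed.

(** Chebyshev's inequality pointwise: [t] can reach position [J o] only if its count exceeds the
    mean by at least the margin [m ^ 2]. *)
Lemma dev_target o f : (m ^ 3 <= b)%N -> (J o < nle lt f t)%N ->
  1 <= dev t f ^+ 2 / (m ^ 2)%:R ^+ 2.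
Proof.
move=> mb jt; have w0 : 0 < (m ^ 2)%:R :> K by rewrite ltr0n expn_gt0 m_gt0.
rewrite -expr_div_n exprn_ege1 // ler_pdivlMr // mul1r /dev -/b -/r.
have sb : (m ^ 3)%:R / b%:R <= 1 :> K by rewrite ler_pdivrMr ?ltr0n // mul1r ler_nat.
have : (quo + m ^ 2 + 3)%:R <= (nle lt f t)%:R :> K.
  by rewrite ler_nat; move: jt; rewrite /J /target_index -/quo; lia.
rewrite !natrD -[r.+1%:R]natr1 mulrDl mul1r mulrDr; move: quo_gt sb; set x := (_ * (_ / _)).
set z := _ / _; set w := (m ^ 2)%:R; set q := quo%:R; set v := (nle _ _ _)%:R; lra.
Qed.

(** A rank gap of [4 * b / m] moves the mean by [4 * m ^ 2], while [J o] is at most [2 * m ^ 2 + 1]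
    beyond the quotient; a deviation of [m ^ 2] is left. *)
Lemma dev_other o f y : (o < m ^ 2)%N -> (4 * b <= m * (rank lt B y - r))%N ->
    (nle lt f y <= J o)%N -> 1 <= dev y f ^+ 2 / (m ^ 2)%:R ^+ 2.
Proof.
move=> ow far yj; have w0 : 0 < (m ^ 2)%:R :> K by rewrite ltr0n expn_gt0 m_gt0.
have w1 : 1 <= (m ^ 2)%:R :> K by rewrite ler1n expn_gt0 m_gt0.
rewrite -expr_div_n -sqrrN exprn_ege1 // -mulNr ler_pdivlMr // mul1r /dev -/b.
have b0 : 0 < b%:R :> K by rewrite ltr0n.
have : (nle lt f y)%:R <= (quo + (m ^ 2 + m ^ 2) + 1)%:R :> K.
  by rewrite ler_nat; move: yj; rewrite /J /target_index -/quo; lia.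
have : (m ^ 3)%:R * (r%:R / b%:R) + 4 * (m ^ 2)%:R
       <= (m ^ 3)%:R * ((rank lt B y).+1%:R / b%:R) :> K.
  rewrite -(ler_pM2r b0) mulrDl -!mulrA !mulVf ?lt0r_neq0 // !mulr1.
  rewrite -!natrM -natrD ler_nat.
  have ry : (r <= rank lt B y)%N by move: far b_gt0; lia.
  have : (m ^ 2 * (4 * b) <= m ^ 2 * (m * (rank lt B y - r)))%N by rewrite leq_mul2l far orbT.
  rewrite [X in (_ <= X)%N]mulnA -(expnSr m 2) -[X in (_ -> _ <= _ * X)%N](subnKC (leqW ry)) subSn //.
  by rewrite mulnDr mulnS; lia.
rewrite !natrD; move: quo_le; set x := (_ * (_ / _)).
set z := (_ * (_ / _)); set w := (m ^ 2)%:R in w0 w1 *; set q := quo%:R; set v := (nle _ _ _)%:R; lra.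
Qed.

(** The ranks of these elements are distinct, above [r], and at most that of the largest of them. *)
Lemma card_near : (m * #|[set y in B | lt t y & m * (rank lt B y - r) < 4 * b]| <= 4 * b)%N.
Proof.
set X := [set _ in _ | _ & _]; have [->|[y0 y0X]] := set_0Vmem X.
  by rewrite cards0 muln0.
have [y yX ymax] := @arg_maxnP _ y0 (mem X) key y0X.
move: (yX); rewrite /= /X inE /= => /and3P[yB ty /ltnW]; apply: leq_trans; rewrite leq_mul2l; apply/orP; right.
rewrite leq_subRL; last first.
  by apply/subset_leq_card/subsetP => u; rewrite !inE /= => /andP[-> /ltn_trans->].
rewrite -ltnS -card_le_rank // -addSn -card_le_rank // -cardsUI.
rewrite [X in (_ + X)%N](_ : _ = 0%N) ?addn0; last first.
  apply/eqP; rewrite cards_eq0; apply/eqP/setP => u; rewrite !inE /=.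
  case: (u \in B) => //=; case: eqVneq => [->|_]; rewrite ?ltnn // orbF.
  by case: ltngtP.
apply/subset_leq_card/subsetP => u /setUP[|uX]; rewrite !inE /=.
  by case/andP=> -> /= /orP[/ltn_trans->|/eqP->]; rewrite ?ty.
move: (uX); rewrite /X inE => /and3P[-> _ _] /=; have /ymax /= := uX.
by rewrite leq_eqVlt orbC => /orP[->//|/eqP/key_inj->]; rewrite eqxx orbT.
Qed.

(** For a fixed sample, distinct offsets with pivot [t] use distinct positions, at most the
    multiplicity of [t]; and a single such offset forces a large deviation. *)
Lemma pivot_hits f : (m ^ 3 <= b)%N ->
  \sum_(o < m ^ 2) (pivot lt f (J o) == Some t)%:R
    <= \sum_i (f i == t)%:R * dev t f ^+ 2 / (m ^ 2)%:R ^+ 2 :> K.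
Proof.
move=> mb; rewrite -mulr_suml -mulr_suml.
have [o0 /eqP h0|none] := pickP (fun o : 'I_(m ^ 2) => pivot lt f (J o) == Some t); last first.
  rewrite big1 => [|o _]; last by rewrite none.
  by rewrite mulr_ge0 ?invr_ge0 ?exprn_ge0 // mulr_ge0 ?sqr_ge0 ?sumr_ge0.
have /andP[_ jt] := pivot_bounds h0.
rewrite -mulrA; apply: (@le_trans _ _ (\sum_i (f i == t)%:R)); last first.
  by rewrite ler_peMr ?sumr_ge0 // (dev_target mb jt).
rewrite -!natr_sum ler_nat.
rewrite (eq_bigr (fun o : 'I_(m ^ 2) => if pivot lt f (J o) == Some t then 1%N else 0%N)) => [|o _]; last by case: eqP.
rewrite (eq_bigr (fun i => if f i == t then 1%N else 0%N)) => [|i _]; last by case: eqP.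
rewrite -!big_mkcond !sum1_card.
apply: (@leq_trans (nle lt f t - nlt lt f t)).
  rewrite cardE -(size_map (fun o : 'I_(m ^ 2) => J o) (enum _)).
  rewrite -(size_iota (nlt lt f t) (nle lt f t - nlt lt f t)) uniq_leq_size //.
    rewrite map_inj_uniq ?enum_uniq // => o1 o2 /eqP.
    by rewrite /J /target_index eqn_add2l => /eqP/ord_inj.
  move=> _ /mapP[o + ->]; rewrite mem_enum => oh.
  have /eqP/pivot_bounds/andP[H1 H2] : pivot lt f (J o) == Some t by exact: oh.
  by rewrite mem_iota H1 /= subnKC // (leq_trans H1) // ltnW.
rewrite leq_subLR -cardsE; apply: leq_trans (leq_card_setU _ _).
by apply/subset_leq_card/subsetP => i; rewrite !inE.
Qed.

(** Each of the [m ^ 3] coordinates equals [t] with probability [1 / b] and then contributes a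
    variance term [m ^ 3 / m ^ 4], which gives [m ^ 2 / b] hits on average. So a uniform offset
    yields [t] with probability at most [1 / b]; denominators are cleared. *)
Lemma mean_pivot_hits : (m ^ 3 <= b)%N ->
  b%:R * (\sum_(f | sample f) \sum_(o < m ^ 2) (pivot lt f (J o) == Some t)%:R)
    <= b%:R ^+ (m ^ 3) * (m ^ 2)%:R :> K.
Proof.
move=> mb; have w0 : 0 < (m ^ 2)%:R :> K by rewrite ltr0n expn_gt0 m_gt0.
apply: (@le_trans _ _ (b%:R * (\sum_(i < m ^ 3) (m ^ 3)%:R *
    (\sum_(f | sample f) (f i == t)%:R) / (m ^ 2)%:R ^+ 2))).
  rewrite ler_wpM2l //.
  apply: (@le_trans _ _ (\sum_(f | sample f) \sum_i (f i == t)%:R * dev t f ^+ 2 / (m ^ 2)%:R ^+ 2)).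
    by apply: ler_sum => f _; apply: pivot_hits.
  rewrite exchange_big; apply: ler_sum => i _; rewrite -mulr_suml.
  rewrite ler_wpM2r ?invr_ge0 ?exprn_ge0 //.
  exact: (@dev_second_moment (fun u => (u == t)%:R)).
rewrite (eq_bigr (fun=> (m ^ 3)%:R * b%:R^-1 * b%:R ^+ (m ^ 3) / (m ^ 2)%:R ^+ 2)) => [|i _].
  rewrite sumr_const card_ord -[_ *+ (m ^ 3)]mulr_natl.
  have b0 : b%:R != 0 :> K by rewrite pnatr_eq0 -lt0n.
  have m0 : m%:R != 0 :> K by rewrite pnatr_eq0 -lt0n.
  by rewrite !natrX; apply/eq_imp_le; field; rewrite b0 m0.
congr (_ / _); rewrite -mulrA; congr (_ * _).
have b0 : b%:R != 0 :> K by rewrite pnatr_eq0 -lt0n.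
apply: (mulfI b0); rewrite mulVKf // (sum_sample_coord _ (fun u => (u == t)%:R)).
by rewrite (bigD1 t) //= eqxx big1 ?addr0 ?mulr1 // => u /andP[_ /negPf->].
Qed.

(** Only the candidates above [t]; without a pivot all of them survive. *)
Definition survivors f o :=
  [set y in B | lt t y & oapp (fun p => same_side lt t p y) true (pivot lt f (J o))].

(** By [pivot_side], a survivor is near [t] in rank, or its own count deviates, or that of [t] does;
    the last event is charged once for each element of [B]. *)
Lemma card_survivors f o : (m ^ 3 <= b)%N -> (o < m ^ 2)%N ->
  #|survivors f o|%:R <= 4 * b%:R / m%:R +
    (\sum_(y in B) dev y f ^+ 2 / (m ^ 2)%:R ^+ 2 + b%:R * (dev t f ^+ 2 / (m ^ 2)%:R ^+ 2)).
Proof.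
move=> mb ow; set X := [set y in B | lt t y & (m * (rank lt B y - r) < 4 * b)%N].
have dev0 y : 0 <= dev y f ^+ 2 / (m ^ 2)%:R ^+ 2.
  by rewrite divr_ge0 ?sqr_ge0.
have Xle : #|X|%:R <= 4 * b%:R / m%:R :> K.
  by rewrite ler_pdivlMr ?ltr0n // mulrC -!natrM ler_nat card_near.
apply: le_trans (lerD Xle (lexx _)); rewrite -lerBlDl.
have -> : b%:R * (dev t f ^+ 2 / (m ^ 2)%:R ^+ 2)
   = \sum_(y in B) (dev t f ^+ 2 / (m ^ 2)%:R ^+ 2) by rewrite sumr_const mulr_natl.
have cardE (A : {set T}) : #|A|%:R = \sum_y (y \in A)%:R :> K.
  by rewrite -sum1_card natr_sum big_mkcond; apply: eq_bigr => y _; case: ifP.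
rewrite -big_split /= !cardE -sumrB [leRHS]big_mkcond.
apply: ler_sum => y _; rewrite !inE /=.
case yB: (y \in B) => /=; last by rewrite subr0.
case: (ltnP (key t) (key y)) => ty /=; last by rewrite subr0 addr_ge0.
case: ltnP => far /=; first by case: (oapp _ _ _); rewrite ?subrr ?addr_ge0 // sub0r; rewrite (@le_trans _ _ 0) ?oppr_le0 ?addr_ge0.
case side: (oapp _ _ _) => /=; rewrite subr0 ?addr_ge0 //.
have /orP[jt|yj] := @pivot_side _ _ _ key_inj f (J o) t y ty (fun p Hp => ltac:(by move: side; rewrite Hp)).
  by rewrite (le_trans (dev_target mb jt)) // lerDr.
by rewrite (le_trans (dev_other ow far yj)) // lerDl.
Qed.

(** Each normalised squared deviation has mean at most [m ^ 3 / m ^ 4 = 1 / m], so the three terms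
    give [4 + 1 + 1 = 6] times [b / m]. *)
Lemma mean_survivors : (m ^ 3 <= b)%N ->
  \sum_(f | sample f) \sum_(o < m ^ 2) #|survivors f o|%:R
    <= b%:R ^+ (m ^ 3) * (m ^ 2)%:R * (6 * b%:R / m%:R) :> K.
Proof.
move=> mb; have m0 : m%:R != 0 :> K by rewrite pnatr_eq0 -lt0n.
have i0 : 'I_(m ^ 3) by apply: (@Ordinal _ 0); rewrite expn_gt0 m_gt0.
have dev1 y : y \in B -> \sum_(f | sample f) dev y f ^+ 2 / (m ^ 2)%:R ^+ 2 <= b%:R ^+ (m ^ 3) / m%:R.
  move=> yB; rewrite -mulr_suml.
  have := @dev_second_moment (fun=> 1) i0 y yB (fun=> ler01).
  rewrite (eq_bigr (fun f => dev y f ^+ 2)) => [|f _]; last by rewrite mul1r.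
  rewrite sum_sample_const => H.
  apply: (@le_trans _ _ ((m ^ 3)%:R * b%:R ^+ (m ^ 3) / (m ^ 2)%:R ^+ 2)).
    by rewrite ler_wpM2r ?invr_ge0 ?exprn_ge0.
  by rewrite !natrX; apply/eq_imp_le; field.
apply: (@le_trans _ _ (\sum_(f | sample f) \sum_(o < m ^ 2) (4 * b%:R / m%:R +
    (\sum_(y in B) dev y f ^+ 2 / (m ^ 2)%:R ^+ 2 + b%:R * (dev t f ^+ 2 / (m ^ 2)%:R ^+ 2))))).
  by apply: ler_sum => f _; apply: ler_sum => o _; apply: card_survivors.
rewrite (eq_bigr (fun f => (m ^ 2)%:R * (4 * b%:R / m%:R +
    (\sum_(y in B) dev y f ^+ 2 / (m ^ 2)%:R ^+ 2 + b%:R * (dev t f ^+ 2 / (m ^ 2)%:R ^+ 2))))) => [|f _]; last first.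
  by rewrite sumr_const card_ord -[_ *+ (m ^ 2)]mulr_natl.
rewrite -mulr_sumr [leRHS]mulrAC [leRHS]mulrC ler_wpM2l //.
have split3 (F G H : {ffun 'I_(m ^ 3) -> T} -> K) : \sum_(f | sample f) (F f + (G f + H f))
   = \sum_(f | sample f) F f + (\sum_(f | sample f) G f + \sum_(f | sample f) H f).
  by rewrite !big_split.
rewrite split3 -[X in _ + (_ + X)]mulr_sumr.
have -> : \sum_(f | sample f) (4 * b%:R / m%:R) = b%:R ^+ (m ^ 3) * (4 * b%:R / m%:R) :> K.
  by rewrite -sum_sample_const mulr_suml; apply: eq_bigr => f _; rewrite mul1r.
have H2 : \sum_(f | sample f) \sum_(y in B) dev y f ^+ 2 / (m ^ 2)%:R ^+ 2
   <= b%:R * (b%:R ^+ (m ^ 3) / m%:R).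
  rewrite exchange_big /= mulr_natl -sumr_const; apply: ler_sum => y yB; exact: dev1.
have H3 := ler_wpM2l (ler0n K b) (dev1 t tB).
apply: le_trans (lerD (lexx _) (lerD H2 H3)) _.
by apply/eq_imp_le; field.
Qed.

End PivotMoments.

(** * Partitioning and one round of the search *)

Section Procedures.
Variables (n : nat) (d : 'I_n).
Implicit Types (B : {set 'I_n}) (st : {set 'I_n} * nat).

(* The state [(B, r)] stands for the search of the element of rank [r] in [B];
   it becomes [([set p], 0)] once that element is known to be the pivot [p]. *)
Definition partition p st : prog n ({set 'I_n} * nat) :=
  bind (compares [seq (y, p) | y <- enum (st.1 :\ p)]) (fun s =>
    let lo := [set y in st.1 | (y, p) \in s] in
    Done (if (st.2 < #|lo|)%N then (lo, st.2)
          else if (p \in st.1) && (st.2 == #|lo|) then ([set p], 0%N)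
          else ((st.1 :\ p) :\: lo, (st.2 - #|lo| - (p \in st.1))%N))).

Fixpoint partitions (P : seq 'I_n) st : prog n ({set 'I_n} * nat) :=
  if P is p :: P' then bind (partition p st) (partitions P') else Done st.

Definition compare_all B := compares (enum (setX B B)).

Definition naive_select B r : prog n 'I_n :=
  bind (compare_all B) (fun s =>
    Done (odflt d [pick y in B | #|[set u in B | (u, y) \in s]| == r])).

(** The uniform pivot [v] makes every round shrink the set, whatever the sample gives. The left
    pivot is a right pivot for the reversed order, in which the rank is [b - 1 - r]. *)
Definition round m st : prog n ({set 'I_n} * nat) :=
  bind (uniform d (enum st.1)) (fun v =>
  bind (uniform [ffun=> d]
         (enum [pred f : {ffun 'I_(m ^ 3) -> 'I_n} | f \in ffun_on (mem st.1)])) (fun f =>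
  bind (uniform 0%N (iota 0 (m ^ 2))) (fun o =>
  bind (compare_all [set f i | i : 'I_(m ^ 3)]) (fun s =>
    partitions
      (v :: seq_of_opt (pivot (fun x y => (x, y) \in s) f (target_index #|st.1| m st.2 o))
         ++ seq_of_opt (pivot (fun x y => (y, x) \in s) f
                          (target_index #|st.1| m (#|st.1|.-1 - st.2) o))) st)))).

End Procedures.

(** * Correctness and cost of partitioning and of exhaustive comparison *)

Section Analysis.
Variables (K : realFieldType) (n : nat) (d : 'I_n) (key : 'I_n -> nat).
Hypothesis key_inj : injective key.
Notation lt := (relpre key ltn).
Implicit Types (B : {set 'I_n}) (t : 'I_n).

Lemma rank_lt B t u : u \in B -> lt u t -> (rank lt B u < rank lt B t)%N.
Proof.
move=> uB ut; apply/proper_card/properP; split.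
  by apply/subsetP => y; rewrite !inE /= => /andP[-> /ltn_trans->].
by exists u; rewrite !inE ?uB ?ut //= ltnn.
Qed.

Lemma rank_inj B : {in B &, injective (rank lt B)}.
Proof.
move=> t u tB uB tu; apply: key_inj; case: (ltngtP (key t) (key u)) => // H.
  by have := rank_lt tB H; rewrite tu ltnn.
by have := rank_lt uB H; rewrite tu ltnn.
Qed.

Lemma rank_lt_card B t : t \in B -> (rank lt B t < #|B|)%N.
Proof.
move=> tB; apply/proper_card/properP; split.
  by apply/subsetP => u; rewrite inE => /andP[].
by exists t; rewrite // inE /= ltnn andbF.
Qed.

Definition part t p B :=
  if t == p then [set t] else [set y in B | (y != p) && (lt y p == lt t p)].

(** [p] may lie outside [B], having been discarded by an earlier pivot of the same round; hence
    [p \in B] enters the rank computation. *)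
Lemma supp_partition B t p : t \in B ->
  supp lt (partition p (B, rank lt B t)) (eq (part t p B, rank lt (part t p B) t)).
Proof.
move=> tB; apply: supp_bind; apply: supp_impl (supp_compares _ _) _ => _ <- /=.
set lo := [set y in B | _].
have {lo}-> : lo = [set y in B | lt y p].
  apply/setP => y; rewrite !inE mem_filter /=; case yB: (y \in B) => //=.
  case yp: (key y < key p)%N => //=; apply/mapP; exists y => //.
  by rewrite mem_enum !inE yB andbT; apply: contraTneq yp => ->; rewrite ltnn.
set lo := [set y in B | _]; rewrite /part.
have tcase : (t == p) = (key t == key p) by rewrite (inj_eq key_inj).
have [tp|tp|tp] := ltngtP (key t) (key p); rewrite tcase ?(ltn_eqF tp) ?(gtn_eqF tp) ?tp ?eqxx.
- have E : [set y in B | (y != p) && (lt y p == lt t p)] = lo.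
    apply/setP => y; rewrite !inE /= tp eqb_id; case: (y \in B) => //=.
    by case: eqVneq => // ->; rewrite ltnn.
  have -> : (rank lt B t < #|lo|)%N.
    apply/proper_card/properP; split.
      by apply/subsetP => y; rewrite !inE /= => /andP[-> /ltn_trans->].
    by exists t; rewrite !inE ?tB //= ltnn.
  rewrite E; congr (_, _); apply: eq_card => y; rewrite !inE /=.
  by case: (y \in B) => //=; case: (ltnP (key y) (key t)) => [/ltn_trans->|]; rewrite ?andbF.
- have -> : (rank lt B t < #|lo|)%N = false.
    apply/negbTE; rewrite -leqNgt; apply/subset_leq_card/subsetP => y.
    by rewrite !inE /= => /andP[-> /ltn_trans->].
  have E : [set y in B | (y != p) && (lt y p == lt t p)] = (B :\ p) :\: lo.
    apply/setP => y; rewrite !inE /= (ltnNge (key t)) (ltnW tp) eqbF_neg.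
    by case: (y \in B); rewrite /= ?andbF ?andbT // andbC.
  rewrite E.
  have EB : rank lt B t = (#|lo| + (p \in B) + rank lt ((B :\ p) :\: lo) t)%N.
    rewrite /rank -[LHS](cardsID lo) -addnA; congr (_ + _)%N.
      by apply: eq_card => y; rewrite !inE /=; case: (y \in B) => //=; rewrite andbC;
         case: ltnP => //= yp; rewrite (ltn_trans yp tp).
    rewrite (cardsD1 p) !inE /= ltnn tp !andbT andbF /=; congr (_ + _)%N.
    apply: eq_card => y; rewrite !inE /=.
    by case: (y == p); case: (y \in B); case: (key y < key p)%N => //=; rewrite ?andbF.
  have -> : (p \in B) && (rank lt B t == #|lo|) = false.
    by case: (p \in B) EB => //= ->; rewrite -addnA -[X in _ == X]addn0 eqn_add2l.
  by rewrite EB -subnDA addKn.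
- have /key_inj E : key t = key p by [].
  have -> : rank lt B t = #|lo| by rewrite /rank /lo E.
  rewrite ltnn -E tB eqxx /=; congr (_, _); apply/eqP; rewrite /rank cards_eq0.
  by apply/eqP/setP => y; rewrite !inE /=; case: eqVneq => // ->; rewrite ltnn.
Qed.

(** As an ordinary element [t] meets only the pivot; as the pivot it meets all others. *)
Lemma cost_partition B t p r : t \in B ->
  cost lt t (partition p (B, r)) <= 1 + (p == t)%:R * #|B|%:R :> K.
Proof.
move=> tB; rewrite cost_bind ex_const addr0 cost_compares count_map /=.
case: eqVneq => [->|/negPf pt] /=.
  rewrite mul1r nat1r ler_nat (leq_trans (count_size _ _)) // -cardE.
  by rewrite (leq_trans _ (leqnSn _)) // subset_leq_card // subsetDl.
rewrite mul0r addr0 lern1 (eq_count (a2 := pred1 t)) => [|y]; last by rewrite /= pt orbF.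
by apply: leq_trans (leq_b1 (t \in enum (B :\ p))); rewrite -count_uniq_mem ?enum_uniq.
Qed.

Lemma part_mem B t p : t \in B -> t \in part t p B.
Proof. by rewrite /part; case: eqVneq => tp tB; rewrite !inE ?tB ?tp ?eqxx. Qed.

Lemma part_sub B t p : t \in B -> part t p B \subset B.
Proof.
rewrite /part; case: eqVneq => _ tB; first by rewrite sub1set.
by apply/subsetP => y; rewrite inE => /andP[].
Qed.

Lemma part_side B t p y : y \in part t p B -> y != t -> same_side lt t p y.
Proof.
rewrite /part /same_side; case: eqVneq => tp; rewrite !inE.
  by move=> ->.
by case/andP.
Qed.

Lemma supp_partitions P B t : t \in B ->
  supp lt (partitions P (B, rank lt B t)) (fun st =>
    [/\ t \in st.1, st.2 = rank lt st.1 t, st.1 \subset B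
      & forall p y, p \in P -> y \in st.1 -> y != t -> same_side lt t p y]).
Proof.
elim: P B => [|p P IH] B tB /=; first by split.
apply/supp_bind/(supp_impl (supp_partition p tB)) => _ <-.
apply: supp_impl (IH _ (part_mem p tB)) _ => st [tst rst stB side].
split=> //; first exact: subset_trans stB (part_sub p tB).
move=> q y; rewrite inE => /orP[/eqP->|]; last exact: side.
by move=> /(subsetP stB)/part_side.
Qed.

Lemma cost_partitions P B t : t \in B ->
  cost lt t (partitions P (B, rank lt B t)) <= (size P)%:R + (count_mem t P)%:R * #|B|%:R :> K.
Proof.
elim: P B => [|p P IH] B tB /=; first by rewrite mul0r addr0.
rewrite cost_bind (ex_val _ (supp_partition p tB)).
apply: le_trans (lerD (cost_partition p _ tB) (IH _ (part_mem p tB))) _.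
rewrite -nat1r natrD mulrDl addrACA !lerD // ler_wpM2l // ler_nat.
exact/subset_leq_card/part_sub.
Qed.

Lemma supp_compare_all B :
  supp lt (compare_all B) (fun s => {in B &, forall x y, ((x, y) \in s) = lt x y}).
Proof.
apply: supp_impl (supp_compares _ _) _ => _ <- x y xB yB.
by rewrite mem_filter mem_enum in_setX xB yB /= andbT.
Qed.

Lemma cost_compare_all B t :
  cost lt t (compare_all B) <= (t \in B)%:R * (2 * #|B|%:R) :> K.
Proof.
rewrite cost_compares.
have -> : count (fun q => (q.1 == t) || (q.2 == t)) (enum (setX B B))
    = #|[set q in setX B B | (q.1 == t) || (q.2 == t)]|.
  rewrite -size_filter cardE; apply/perm_size/uniq_perm => [||q]; [exact/filter_uniq/enum_uniq|exact: enum_uniq|].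
  by rewrite mem_filter !mem_enum !inE andbC.
case tB: (t \in B); last first.
  rewrite mul0r lern0 cards_eq0; apply/eqP/setP => -[x y]; rewrite !inE /=.
  apply/negP => /andP[/andP[xB yB]] /orP[] /eqP E; by rewrite -E ?xB ?yB in tB.
rewrite mul1r -natrM ler_nat mul2n -addnn.
have H1 : #|setX [set t] B| = #|B| by rewrite cardsX cards1 mul1n.
have H2 : #|setX B [set t]| = #|B| by rewrite cardsX cards1 muln1.
rewrite -{1}H1 -H2; apply: leq_trans (leq_card_setU _ _).
apply/subset_leq_card/subsetP => -[x y]; rewrite !inE /=.
by case/andP=> /andP[xB yB] /orP[] ->; rewrite ?xB ?yB ?orbT.
Qed.

Lemma supp_naive_select B t : t \in B ->
  supp lt (naive_select d B (rank lt B t)) (eq t).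
Proof.
move=> tB; apply/supp_bind/(supp_impl (supp_compare_all B)) => s Hs /=.
have E y : y \in B -> #|[set u in B | (u, y) \in s]| = rank lt B y.
  move=> yB; apply: eq_card => u; rewrite !inE.
  by case uB: (u \in B); rewrite //= Hs.
case: pickP => [y /andP[yB]|/(_ t)] /=; last by rewrite tB E // eqxx.
by rewrite E // => /eqP/rank_inj->.
Qed.

Lemma cost_naive_select B r t :
  cost lt t (naive_select d B r) <= 2 * #|B|%:R :> K.
Proof.
rewrite cost_bind ex_const addr0 (le_trans (cost_compare_all _ _)) //.
by rewrite ler_piMl ?mulr_ge0 // lern1 leq_b1.
Qed.

End Analysis.
Arguments partitions {n} P st : simpl never.

(** * Mean size and mean cost of one round *)

Section RoundAnalysis.
Variables (K : realFieldType) (n : nat) (d : 'I_n) (key : 'I_n -> nat).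
Hypothesis key_inj : injective key.
Notation lt := (relpre key ltn).

(** A key for the reversed order, so that bounds for right pivots apply to left pivots. *)
Definition rev_key i := (\max_j key j - key i)%N.
Notation gt := (relpre rev_key ltn).

Lemma gtE x y : (rev_key x < rev_key y)%N = (key y < key x)%N.
Proof.
rewrite /rev_key; have := leq_bigmax (F := key) x; have := leq_bigmax (F := key) y.
by move=> *; apply/idP/idP; lia.
Qed.

Lemma rev_key_inj : injective rev_key.
Proof.
move=> x y; rewrite /rev_key => E; apply: key_inj.
by have := leq_bigmax (F := key) x; have := leq_bigmax (F := key) y; lia.
Qed.

Lemma rank_rev (B : {set 'I_n}) t : t \in B -> rank gt B t = (#|B|.-1 - rank lt B t)%N.
Proof.
move=> tB; rewrite (cardsD1 t B) tB add1n /= -(cardsID [set u | lt u t] (B :\ t)).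
rewrite [X in (X + _ - _)%N](_ : _ = rank lt B t) ?addKn; last first.
  apply: eq_card => u; rewrite !inE; case: eqVneq => [->|] //=.
  by rewrite ltnn !andbF.
apply: eq_card => u; rewrite !inE /= gtE.
case: (ltngtP (key t) (key u)) => [tu|tu|/key_inj->]; rewrite ?eqxx ?andbF //.
by rewrite andbT /=; case: eqVneq tu => // ->; rewrite ltnn.
Qed.

Variables (B : {set 'I_n}) (t : 'I_n) (m : nat).
Hypotheses (tB : t \in B) (m_gt0 : (0 < m)%N).
Let b := #|B|.
Let b_gt0 : (0 < b)%N. Proof. by apply/card_gt0P; exists t. Qed.
Let sample := [pred f : {ffun 'I_(m ^ 3) -> 'I_n} | f \in ffun_on (mem B)].

Let size_sample : size (enum sample) = (b ^ m ^ 3)%N.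
Proof. by rewrite -cardE card_ffun_on card_ord. Qed.

Let right_pivot (f : {ffun 'I_(m ^ 3) -> 'I_n}) o := pivot lt f (target_index b m (rank lt B t) o).
Let left_pivot (f : {ffun 'I_(m ^ 3) -> 'I_n}) o := pivot gt f (target_index b m (rank gt B t) o).
Let pivots v (f : {ffun 'I_(m ^ 3) -> 'I_n}) o :=
  v :: seq_of_opt (right_pivot f o) ++ seq_of_opt (left_pivot f o).

(** The mean over the three independent draws of a round. *)
Let exs (F : 'I_n -> {ffun 'I_(m ^ 3) -> 'I_n} -> nat -> K) :=
  ex lt (uniform d (enum B)) (fun v =>
    ex lt (uniform [ffun=> d] (enum sample)) (fun f =>
      ex lt (uniform 0%N (iota 0 (m ^ 2))) (fun o => F v f o))).

Let exsD F G : exs (fun v f o => F v f o + G v f o) = exs F + exs G.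
Proof.
rewrite /exs -exD; apply/ex_eq/supp_true => v; rewrite -exD; apply/ex_eq/supp_true => f.
exact: exD.
Qed.

Let exs_sample (F : {ffun 'I_(m ^ 3) -> 'I_n} -> nat -> K) :
  exs (fun _ => F) = (b%:R ^+ (m ^ 3) * (m ^ 2)%:R)^-1
     * \sum_(f | sample f) \sum_(o < m ^ 2) F f o.
Proof.
rewrite /exs ex_const ex_draw ?size_sample ?expn_gt0 ?b_gt0 // natrX invfM -mulrA; congr (_ * _).
rewrite big_enum mulr_sumr; apply: eq_bigr => f _.
rewrite ex_draw ?size_iota ?expn_gt0 ?m_gt0 //; congr (_ * _).
by rewrite -[X in iota 0 X]subn0 big_mkord.
Qed.

Let pivotsE v (f : {ffun 'I_(m ^ 3) -> 'I_n}) o (s : seq ('I_n * 'I_n)) :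
    {in [set f i | i : 'I_(m ^ 3)] &, forall x y, ((x, y) \in s) = lt x y} ->
  v :: seq_of_opt (pivot (fun x y => (x, y) \in s) f (target_index b m (rank lt B t) o))
    ++ seq_of_opt (pivot (fun x y => (y, x) \in s) f (target_index b m (b.-1 - rank lt B t) o))
  = pivots v f o.
Proof.
move=> Hs; congr (_ :: (seq_of_opt _ ++ seq_of_opt _)); first exact: eq_pivot.
by rewrite -rank_rev //; apply: eq_pivot => x y xf yf; rewrite Hs //= gtE.
Qed.

(** The pivot [v] belongs to [B]: it is removed, or it is [t] and only [t] remains. *)
Lemma supp_round : supp lt (round d m (B, rank lt B t)) (fun st =>
  [/\ t \in st.1, st.2 = rank lt st.1 t & (1 < #|B|)%N -> (#|st.1| < #|B|)%N]).
Proof.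
apply: supp_bind; apply: (@supp_draw _ _ 'I_n) => [|v]; first by rewrite -cardE.
rewrite mem_enum => vB.
apply/supp_bind/supp_true => f; apply/supp_bind/supp_true => o.
apply/supp_bind/(supp_impl (supp_compare_all _ _)) => s Hs.
rewrite /= pivotsE //; apply: supp_impl (supp_partitions key_inj _ tB) _ => st [tst rst stB side].
split=> // B1; have [tv|tv] := eqVneq t v.
  suff -> : st.1 = [set t] by rewrite cards1.
  apply/setP => y; rewrite inE; apply/idP/eqP => [yst|->//]; apply/eqP; apply: contraT => yt.
  by have /and3P[] := side v y (mem_head _ _) yst yt; rewrite tv eqxx.
apply/proper_card/properP; split=> //; exists v => //; apply/negP => vst.
have := side v v (mem_head _ _) vst; rewrite eq_sym => /(_ tv)/and3P[_].
by rewrite eqxx.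
Qed.

Let surv_right f o := @survivors _ key B m t f o.
Let surv_left f o := @survivors _ rev_key B m t f o.

(** What remains is [t], the survivors above it and those below it, each side having mean at most
    [6 * b / m]. *)
Lemma mean_size_round : (m ^ 3 <= b)%N ->
  ex lt (round d m (B, rank lt B t)) (fun st => #|st.1|%:R) <= 1 + 12 * b%:R / m%:R :> K.
Proof.
move=> mb; rewrite /round ex_bind.
apply: (@le_trans _ _ (exs (fun v f o => 1 + (#|surv_right f o|%:R + #|surv_left f o|%:R)))).
  apply/ex_le/supp_true => v; rewrite ex_bind; apply/ex_le/supp_true => f.
  rewrite ex_bind; apply/ex_le/supp_true => o; rewrite ex_bind -[leRHS](ex_const lt (compare_all [set f i | i : 'I_(m ^ 3)])).
  apply: ex_le; apply: supp_impl (supp_compare_all _ _) _ => s Hs.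
  rewrite /= pivotsE // -[leRHS](ex_const lt (partitions (pivots v f o) (B, rank lt B t))).
  apply/ex_le/(supp_impl (supp_partitions key_inj _ tB)) => st [tst rst stB side].
  rewrite -natrD nat1r ler_nat -add1n -[X in (_ <= X + _)%N](cards1 t).
  apply: (leq_trans (n := #|[set t] :|: (surv_right f o :|: surv_left f o)|)); last first.
    by rewrite (leq_trans (leq_card_setU _ _)) // leq_add2l leq_card_setU.
  apply/subset_leq_card/subsetP => y yst; rewrite in_setU1 in_setU.
  case: eqVneq => //= yt; have yB := subsetP stB _ yst.
  have [ty|ty|/key_inj E] := ltngtP (key t) (key y); last by rewrite E eqxx in yt.
    apply/orP; left; rewrite inE yB /= ty /=.
    case E: (pivot _ _ _) => [p|] //=; apply: (side p y) => //.
    by rewrite inE mem_cat /right_pivot E mem_head orbT.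
  apply/orP; right; rewrite inE yB /= gtE ty /=.
  case E: (pivot _ _ _) => [p|] //=.
  suff : same_side lt t p y.
    rewrite /same_side /= !gtE => /and3P[pt yp /eqP yt'].
    rewrite pt yp /= (ltnNge _ (key y)) (leq_eqVlt (key y)) (inj_eq key_inj) (negPf yp) /= yt'.
    by rewrite (ltnNge _ (key t)) (leq_eqVlt (key t)) (inj_eq key_inj) (eq_sym t) (negPf pt) eqxx.
  by apply: (side p y) => //; rewrite inE mem_cat /left_pivot E mem_head !orbT.
have c_gt0 : 0 < b%:R ^+ (m ^ 3) * (m ^ 2)%:R :> K.
  by rewrite mulr_gt0 ?exprn_gt0 // ltr0n // expn_gt0 m_gt0.
have mean k (k_inj : injective k) : exs (fun _ f o => #|@survivors _ k B m t f o|%:R) <= 6 * b%:R / m%:R.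
  by rewrite exs_sample mulrC ler_pdivrMr // mulrC; apply: mean_survivors.
rewrite 2!exsD; have -> : exs (fun _ _ _ => 1) = 1 by rewrite /exs !ex_const.
rewrite lerD2l; apply: le_trans (lerD (mean _ key_inj) (mean _ rev_key_inj)) _.
by rewrite -!mulrDl -natrD.
Qed.

(** The 8 is 3 for meeting at most three pivots, 1 for each pivot that may be [t] itself, and 2 for
    the sample: [t] occurs in it [m ^ 3 / b] times on average, at a cost of at most [2 * m ^ 3], and
    [m ^ 6 <= b]. *)
Lemma cost_round : (m ^ 6 <= b)%N -> cost lt t (round d m (B, rank lt B t)) <= 8 :> K.
Proof.
move=> mb.
have mb3 : (m ^ 3 <= b)%N by apply: leq_trans mb; rewrite leq_pexp2l.
pose hit (p : option 'I_n) : K := (p == Some t)%:R.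
apply: (@le_trans _ _ (exs (fun v f o => 3 + ((\sum_i (f i == t)%:R * (2 * (m ^ 3)%:R) + b%:R * (v == t)%:R)
   + (b%:R * hit (right_pivot f o) + b%:R * hit (left_pivot f o)))))).
  rewrite /round cost_bind cost_draw add0r.
  apply/ex_le/supp_true => v; rewrite cost_bind cost_draw add0r; apply/ex_le/supp_true => f.
  rewrite cost_bind cost_draw add0r; apply/ex_le/supp_true => o; rewrite cost_bind addrCA.
  rewrite -addrA; apply: lerD.
    apply: le_trans (cost_compare_all _ _ _ _) _; rewrite -mulr_suml.
    apply: ler_pM; rewrite ?mulr_ge0 //; last first.
      by rewrite ler_wpM2l // ler_nat (leq_trans (leq_imset_card _ _)) // card_ord.
    case: imsetP => [[i _ ti]|_]; last by rewrite sumr_ge0.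
    by rewrite (bigD1 i) //= ti eqxx lerDl sumr_ge0.
  rewrite -[leRHS](ex_const lt (compare_all [set f i | i : 'I_(m ^ 3)])).
  apply: ex_le; apply: supp_impl (supp_compare_all _ _) _ => s Hs; rewrite /= pivotsE //.
  apply: le_trans (cost_partitions K key_inj _ tB) _.
  have size_opt (p : option 'I_n) : (size (seq_of_opt p) <= 1)%N by case: p.
  have count_opt (p : option 'I_n) : (count_mem t (seq_of_opt p))%:R = hit p.
    by case: p => [p|] //=; rewrite addn0.
  rewrite addrCA; apply: lerD.
    rewrite ler_nat /= size_cat ltnS.
    exact: leq_trans (leq_add (size_opt _) (size_opt _)) _.
  by rewrite /= count_cat !natrD !count_opt !mulrDl ![_ * b%:R]mulrC.
have c_gt0 : 0 < b%:R ^+ (m ^ 3) * (m ^ 2)%:R :> K.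
  by rewrite mulr_gt0 ?exprn_gt0 // ltr0n // expn_gt0 m_gt0.
have mean k (k_inj : injective k) : exs (fun _ f o =>
    b%:R * hit (pivot (relpre k ltn) f (target_index b m (rank (relpre k ltn) B t) o))) <= 1.
  rewrite exs_sample mulrC ler_pdivrMr // mul1r; under eq_bigr do rewrite -mulr_sumr.
  by rewrite -mulr_sumr; apply: mean_pivot_hits.
have mean_v : exs (fun v _ _ => b%:R * (v == t)%:R) = 1.
  rewrite /exs (@ex_eq _ _ _ _ _ _ (fun v => b%:R * (v == t)%:R)); last first.
    by apply/supp_true => v; rewrite !ex_const.
  rewrite ex_draw -cardE // big_enum /= -mulr_sumr (bigD1 t) //= eqxx big1 => [|v /andP[_ /negPf->]] //.
  by rewrite addr0 mulr1 mulVf // pnatr_eq0 -lt0n.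
have mean_cmp : exs (fun _ f _ => \sum_i (f i == t)%:R * (2 * (m ^ 3)%:R)) <= 2.
  rewrite exs_sample mulrC ler_pdivrMr //; set X := \sum_(f | sample f) \sum_i (f i == t)%:R : K.
  have bX : b%:R * X = (m ^ 3)%:R * b%:R ^+ (m ^ 3).
    rewrite /X exchange_big /= mulr_sumr (eq_bigr (fun=> b%:R ^+ (m ^ 3))) => [|i _].
      by rewrite sumr_const card_ord mulr_natl.
    rewrite (sum_sample_coord _ (fun u => (u == t)%:R)) (bigD1 t) //= eqxx big1 ?addr0 ?mulr1 //.
    by move=> u /andP[_ /negPf->].
  have Xs : X * (m ^ 3)%:R <= b%:R ^+ (m ^ 3).
    have b0 : 0 < b%:R :> K by rewrite ltr0n.
    rewrite -(ler_pM2l b0) mulrA bX mulrAC -natrM -expnD ler_wpM2r ?exprn_ge0 //.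
    by rewrite ler_nat.
  have -> : \sum_(f | sample f) \sum_(o < m ^ 2) \sum_i (f i == t)%:R * (2 * (m ^ 3)%:R)
    = 2 * (X * (m ^ 3)%:R * (m ^ 2)%:R).
    rewrite [RHS](_ : _ = X * (2 * (m ^ 3)%:R * (m ^ 2)%:R)); last by ring.
    rewrite mulr_suml; apply: eq_bigr => f _.
    by rewrite sumr_const card_ord -mulr_suml -[_ *+ (m ^ 2)]mulr_natr -mulrA.
  by rewrite ler_wpM2l // ler_wpM2r.
rewrite exsD [X in X + _](_ : _ = 3); last by rewrite /exs !ex_const.
rewrite !exsD.
have := mean _ key_inj; have := mean _ rev_key_inj; move: mean_cmp; rewrite mean_v.
rewrite -/(left_pivot _ _) -/(right_pivot _ _); lra.
Qed.

End RoundAnalysis.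

(** * Reduction to O(k) elements *)

Section Reduction.
Variables (n : nat) (d : 'I_n) (k : nat).
Implicit Types (A B : {set 'I_n}) (st : {set 'I_n} * option 'I_n).

(* In a state [(B, p)] the set [B] consists of the elements treated so far that
   are smaller than [p] (of all of them if [p] is [None]). *)
Definition insert u st : prog n ({set 'I_n} * option 'I_n) :=
  if st.2 is Some q then
    bind (compares [:: (u, q)]) (fun s =>
      Done (if (u, q) \in s then u |: st.1 else st.1, st.2))
  else Done (u |: st.1, None).

Definition prune m st : prog n ({set 'I_n} * option 'I_n) :=
  bind (uniform 0%N (iota 0 m)) (fun c =>
    if (c < 4)%N then
      bind (uniform d (enum st.1)) (fun v =>
      bind (compares [seq (y, v) | y <- enum (st.1 :\ v)]) (fun s =>
        let lo := [set y in st.1 | (y, v) \in s] in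
        Done (if (k <= #|lo|)%N then (lo, Some v) else st)))
    else Done st).

(** The random order is built backwards: the uniform element [u] is treated after all others. *)
Fixpoint reduce m A : prog n ({set 'I_n} * option 'I_n) :=
  if m is m'.+1 then
    bind (uniform d (enum A)) (fun u =>
    bind (reduce m' (A :\ u)) (fun st =>
    bind (insert u st) (prune m)))
  else Done (set0, None).

Definition size_prune m b : prog n nat :=
  bind (uniform 0%N (iota 0 m)) (fun c =>
    if (c < 4)%N then
      bind (uniform 0%N (iota 0 b)) (fun r => Done (if (k <= r)%N then r else b))
    else Done b).

(* The law of the size of the set computed by [reduce]. *)
Fixpoint size_chain m : prog n nat :=
  if m is m'.+1 then
    bind (size_chain m') (fun j =>
    bind (uniform 0%N (iota 0 m)) (fun r => size_prune m (j + (r <= j))%N))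
  else Done 0%N.

End Reduction.

(** * Invariant, cost and mean output size of the reduction *)

Section ReductionAnalysis.
Variables (K : realFieldType) (n : nat) (d : 'I_n) (k : nat) (key : 'I_n -> nat).
Hypotheses (key_inj : injective key) (k_gt0 : (0 < k)%N).
Notation lt := (relpre key ltn).
Implicit Types (A B : {set 'I_n}) (t u v : 'I_n) (p : option 'I_n).

Definition below A p := [set y in A | oapp (lt y) true p].
(** A pivot has at least [k] treated elements below it, so the wanted element is never a pivot and
    never discarded. *)
Definition reduced A (st : {set 'I_n} * option 'I_n) :=
  [/\ st.1 = below A st.2, (#|A| <= k)%N || (k <= #|st.1|)%N
    & forall q, st.2 = Some q -> q \in A /\ (k <= #|st.1|)%N].

(** Whether [u] is below the pivot is decided by comparing its rank with the current size, so the
    size evolves independently of the identities of the elements. *)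
Lemma card_below_insert A u p : u \in A ->
    (forall q, p = Some q -> q \in A /\ q != u) ->
  #|below A p| = (#|below (A :\ u) p| + (rank lt A u <= #|below (A :\ u) p|))%N.
Proof.
move=> uA pu.
have E : #|below A p| = ((u \in below A p) + #|below (A :\ u) p|)%N.
  rewrite (cardsD1 u); congr (_ + _)%N; apply: eq_card => y; rewrite !inE.
  by rewrite andbA.
rewrite E addnC; congr (_ + nat_of_bool _)%N; rewrite inE uA.
case: p pu {E} => [q /(_ q erefl)[qA qu]|_] /=; last first.
  apply/esym/subset_leq_card/subsetP => y; rewrite !inE /= => /andP[-> yu].
  by rewrite !andbT; case: eqVneq yu => // ->; rewrite ltnn.
have [uq|uq|/key_inj E] := ltngtP (key u) (key q); last by rewrite E eqxx in qu.
  apply/esym/subset_leq_card/subsetP => y; rewrite !inE /= => /andP[-> yu].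
  by rewrite (ltn_trans yu uq) andbT; case: eqVneq yu => // ->; rewrite ltnn.
apply/esym/negbTE; rewrite -ltnNge; apply/proper_card/properP; split.
  by apply/subsetP => y; rewrite !inE /= => /andP[/andP[_ ->] /ltn_trans->].
by exists q; rewrite !inE ?qA //= ltnn andbF.
Qed.

(** Ranks enumerate [0, ..., #|A| - 1]: a uniform element has uniform rank. *)
Lemma sum_rank A (H : nat -> K) :
  \sum_(u in A) H (rank lt A u) = \sum_(r <- iota 0 #|A|) H r.
Proof.
rewrite -big_enum -(big_map (rank lt A) predT H); apply/perm_big.
have U : uniq [seq rank lt A u | u <- enum A].
  rewrite map_inj_in_uniq ?enum_uniq // => u v; rewrite !mem_enum.
  exact: rank_inj.
have S : {subset [seq rank lt A u | u <- enum A] <= iota 0 #|A|}.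
  move=> _ /mapP[u uA ->]; rewrite mem_iota /= add0n rank_lt_card //.
  by rewrite mem_enum in uA.
apply: uniq_perm => //; first exact: iota_uniq.
by have [] := uniq_min_size U S; rewrite // size_map size_iota cardE.
Qed.

Lemma supp_insert A u p : u \in A -> (forall q, p = Some q -> q != u) ->
  supp lt (insert u (below (A :\ u) p, p)) (eq (below A p, p)).
Proof.
move=> uA; case: p => [q|] pu /=; congr (_, _); apply/setP => y; rewrite !inE.
  have -> : ((u, q) \in if key u < key q then [:: (u, q)] else [::])%N = (key u < key q)%N.
    by case: ifP; rewrite ?inE ?eqxx.
  case: ifP => uq; rewrite !inE /=.
    by case: eqVneq => [->|] //=; rewrite uA uq.
  by case: eqVneq => [->|] //=; rewrite uq andbF.
by case: eqVneq => [->|] //=; rewrite uA.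
Qed.

Lemma cost_insert t u st :
  cost lt t (insert u st) = (oapp (fun q => (u == t) || (q == t)) false st.2)%:R :> K.
Proof.
by rewrite /insert; case: st.2 => [q|] //=; rewrite !addr0.
Qed.

Let loE B v (s := [seq q <- [seq (y, v) | y <- enum (B :\ v)] | lt q.1 q.2]) :
  [set y in B | (y, v) \in s] = [set y in B | lt y v].
Proof.
apply/setP => y; rewrite !inE mem_filter /=; case yB: (y \in B) => //=.
case yv: (key y < key v)%N => //=; apply/mapP; exists y => //.
by rewrite mem_enum !inE yB andbT; apply: contraTneq yv => ->; rewrite ltnn.
Qed.

Lemma reduced_gt0 A st : (0 < #|A|)%N -> reduced A st -> (0 < #|st.1|)%N.
Proof.
move=> A0 [Bp /orP[Ak|/(leq_trans k_gt0)//] H].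
case E : st.2 Bp => [q|] Bp; first by have [_ /(leq_trans k_gt0)] := H q E.
by rewrite Bp (eq_card (B := mem A)) // => y; rewrite !inE /= andbT.
Qed.

Lemma reduced_insert A u st : u \in A -> reduced (A :\ u) st ->
  reduced A (below A st.2, st.2) /\ forall q, st.2 = Some q -> q \in A /\ q != u.
Proof.
case: st => [B p] uA [/= Bp Bk H].
have BA : (#|B| <= #|below A p|)%N.
  by rewrite Bp; apply/subset_leq_card/subsetP => y; rewrite !inE => /andP[/andP[_ ->]].
split=> [|q /H[]]; last by rewrite !inE => /andP[].
split=> //= [|q /H[]]; last by rewrite !inE => /andP[_ ->] kB; rewrite (leq_trans kB).
case: p H {Bp} Bk BA => [q|] H Bk BA; first by have [_ /leq_trans->] := H q erefl; rewrite ?orbT.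
have -> : below A None = A by apply/setP => y; rewrite !inE andbT.
exact: leq_total.
Qed.

Lemma supp_prune m A st : (0 < #|A|)%N -> reduced A st -> supp lt (prune d k m st) (reduced A).
Proof.
move=> A0 rst; apply/supp_bind/supp_true => c; case: ifP => _; last by [].
have B0 : (0 < size (enum st.1))%N by rewrite -cardE (reduced_gt0 A0).
apply: supp_bind; apply: (@supp_draw _ _ 'I_n) => // v; rewrite mem_enum => vB.
apply: supp_bind; apply: supp_impl (supp_compares _ _) _ => _ <- /=; rewrite loE.
case: ifP => // kv; case: rst => Bp Ak H; split=> /=.
- rewrite Bp; apply/setP => y; rewrite !inE /=; case: (y \in A) => //=.
  rewrite Bp !inE in vB; have /andP[_ vp] := vB.
  case: st.2 vp {Bp Ak H vB} => [q|] //= vq.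
  by case: (ltnP (key y) (key v)) => [/ltn_trans->|_]; rewrite ?andbF.
- by rewrite kv orbT.
by move=> q [<-]; rewrite Bp !inE in vB; have /andP[-> _] := vB.
Qed.

Lemma supp_reduce m A : #|A| = m -> supp lt (reduce d k m A) (reduced A).
Proof.
elim: m A => [|m IH] A Am.
  move/eqP: Am; rewrite cards_eq0 => /eqP-> /=; split=> //=; last by rewrite cards0.
  by apply/setP => y; rewrite !inE.
apply: supp_bind; apply: (@supp_draw _ _ 'I_n) => [|u]; first by rewrite -cardE Am.
rewrite mem_enum => uA; have Au : #|A :\ u| = m by move: Am; rewrite (cardsD1 u) uA => -[].
apply/supp_bind/(supp_impl (IH _ Au)) => -[B p] rst; have [/= rA pu] := reduced_insert uA rst.
have [/= -> _ _] := rst.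
apply/supp_bind/(supp_impl (supp_insert uA (fun q E => proj2 (pu q E)))) => _ <-.
by apply: supp_prune; first by rewrite Am.
Qed.

Lemma sum_ltn_iota a m : \sum_(c <- iota 0 m) (c < a)%N%:R <= a%:R :> K.
Proof.
rewrite -natr_sum ler_nat.
have := sumn_count (fun c => c < a)%N (iota 0 m); rewrite sumnE big_map => ->.
rewrite -size_filter -[leqRHS](size_iota 0); apply: uniq_leq_size.
  exact/filter_uniq/iota_uniq.
by move=> c; rewrite mem_filter !mem_iota /= add0n => /andP[].
Qed.

(** A pivot is tried with probability at most [4 / m]; comparing a set of size [b] with a uniform
    pivot costs [t] at most [1 + b / b = 2] on average. *)
Lemma cost_prune m t (st : {set 'I_n} * option 'I_n) : (0 < m)%N -> (0 < #|st.1|)%N ->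
  cost lt t (prune d k m st) <= (t \in st.1)%:R * (8 / m%:R) :> K.
Proof.
move=> m0 B0; have b0 : 0 < #|st.1|%:R :> K by rewrite ltr0n.
rewrite cost_bind cost_draw add0r ex_draw ?size_iota //.
set X : K := (t \in st.1)%:R * 2.
apply: (@le_trans _ _ (m%:R^-1 * \sum_(c <- iota 0 m) (c < 4)%N%:R * X)).
  rewrite ler_wpM2l ?invr_ge0 //; apply: ler_sum => c _.
  case: (c < 4)%N; last by rewrite mul0r.
  rewrite mul1r cost_bind cost_draw add0r ex_draw -?cardE // mulrC ler_pdivrMr //.
  rewrite big_enum /=.
  apply: (@le_trans _ _ (\sum_(v in st.1) (t \in st.1)%:R * (1 + (v == t)%:R * #|st.1|%:R))).
    apply: ler_sum => v vB; rewrite cost_bind ex_const addr0.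
    case tB: (t \in st.1); last first.
      rewrite mul0r cost_compares lern0 count_map -leqn0 leqNgt -has_count -all_predC.
      apply/allP => y; rewrite mem_enum !inE /= => /andP[_ yB].
      by apply/norP; split; apply: contraFneq tB => <-.
    rewrite mul1r; apply: le_trans (cost_partition K key v 0 tB).
    by rewrite cost_bind ex_const addr0.
  rewrite -mulr_sumr -mulrA ler_wpM2l // big_split /= sumr_const -mulr_suml.
  case tB: (t \in st.1); last first.
    rewrite big1 ?mul0r ?addr0 ?mulr_natl //.
      by rewrite mulr2n lerDl.
    by move=> v vB; case: eqVneq vB => // ->; rewrite tB.
  have -> : \sum_(v in st.1) (v == t)%:R = 1 :> K.
    by rewrite (bigD1 t) //= eqxx big1 ?addr0 // => v /andP[_ /negPf->].
  by rewrite mul1r mulr_natl mulr2n.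
apply: (@le_trans _ _ (m%:R^-1 * (4 * X))); last by apply: eq_imp_le; rewrite /X; ring.
rewrite -mulr_suml ler_wpM2l ?invr_ge0 // ler_wpM2r ?mulr_ge0 //.
exact: sum_ltn_iota.
Qed.

(** The claims are proved together: if the last element [u] is [t], the earlier steps are free by
    the first claim and the cost is at most [1 + 8 / #|A|]; otherwise the second claim gives
    [9 + 8 / #|A|]. *)
Lemma cost_reduce m A t : #|A| = m ->
  (t \notin A -> cost lt t (reduce d k m A) <= 0 :> K) /\
  (t \in A -> (rank lt A t < k)%N -> cost lt t (reduce d k m A) <= 9 :> K).
Proof.
elim: m A => [|m IH] A Am; first by split.
have A0 : (0 < size (enum A))%N by rewrite -cardE Am.
(* At the insertion of [u], [t] takes part only if it is [u] or the pivot, and a pivot has rank at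
   least [k]. *)
have step u : u \in A -> cost lt t (bind (reduce d k m (A :\ u)) (fun st => bind (insert u st) (prune d k m.+1)))
   <= cost lt t (reduce d k m (A :\ u)) + (((u == t) || (t \in A) && (k <= rank lt A t)%N)%:R
      + (t \in A)%:R * (8 / m.+1%:R)) :> K.
  move=> uA; have Au : #|A :\ u| = m by move: Am; rewrite (cardsD1 u) uA => -[].
  rewrite cost_bind lerD2l -[leRHS](ex_const lt (reduce d k m (A :\ u))).
  apply: ex_le; apply: supp_impl (supp_reduce Au) _ => -[B p] rst.
  have [/= rA pu] := reduced_insert uA rst; case: rst => /= Bp Bk H; rewrite Bp.
  rewrite cost_bind (ex_val _ (supp_insert uA (fun q E => proj2 (pu q E)))); apply: lerD.
    rewrite cost_insert ler_nat /=; case: (p) Bp H => [q|] //= Bp /(_ q erefl)[qA kB].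
    case: eqVneq => //= _; case: eqVneq => //= qt; move: qA; rewrite qt !inE => /andP[_ tA].
    rewrite tA /= lt0b (leq_trans kB) // Bp; apply/subset_leq_card/subsetP => y.
    by rewrite !inE qt => /andP[/andP[_ ->]].
  have B0 := reduced_gt0 (_ : 0 < #|A|)%N rA; rewrite Am in B0.
  apply: le_trans (cost_prune _ _ (B0 isT)) _ => //=; rewrite ler_wpM2r ?divr_ge0 //.
  by rewrite ler_nat /below inE; case: (t \in A) => //=; apply: leq_b1.
have bound c : (forall u, u \in A -> cost lt t (bind (reduce d k m (A :\ u))
      (fun st => bind (insert u st) (prune d k m.+1))) <= c u :> K) ->
    cost lt t (reduce d k m.+1 A) <= m.+1%:R^-1 * \sum_(u in A) c u.
  move=> Hc; have -> : cost lt t (reduce d k m.+1 A) = ex lt (uniform d (enum A)) (fun u =>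
     cost lt t (bind (reduce d k m (A :\ u)) (fun st => bind (insert u st) (prune d k m.+1)))) :> K.
    by rewrite -[RHS]add0r -(cost_draw K lt d (enum A) t) -cost_bind.
  rewrite ex_draw // -cardE Am big_enum ler_wpM2l ?invr_ge0 //.
  exact: ler_sum.
split=> [tA|tA tk].
  apply: le_trans (bound (fun=> 0) _) _ => [u uA|]; last by rewrite big1 ?mulr0.
  apply: le_trans (step u uA) _; rewrite (negPf tA) orbF mul0r addr0.
  case: eqVneq uA => [->|ut] uA; first by rewrite uA in tA.
  rewrite addr0; apply: (proj1 (IH _ _)); last by rewrite !inE (negPf tA) andbF.
  by move: Am; rewrite (cardsD1 u) uA => -[].
apply: le_trans (bound (fun u => (if u == t then 1 else 9) + 8 / m.+1%:R) _) _ => [u uA|].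
  have Au : #|A :\ u| = m by move: Am; rewrite (cardsD1 u) uA => -[].
  apply: le_trans (step u uA) _; rewrite tA leqNgt tk orbF mul1r addrA lerD2r.
  case: eqVneq => [E|ut].
    by rewrite gerDr; apply: (proj1 (IH _ Au)); rewrite E !inE eqxx.
  rewrite addr0; apply: (proj2 (IH _ Au)); first by rewrite !inE eq_sym ut.
  apply: leq_ltn_trans tk; apply/subset_leq_card/subsetP => y.
  by rewrite !inE => /andP[/andP[_ ->]].
(* The average is exactly 9, since [1 + 9 * m + 8 = 9 * (m + 1)]. *)
rewrite big_split /= (bigD1 t) //= eqxx (eq_bigr (fun=> 9)) => [|u /andP[_ /negPf->]] //.
have -> : \sum_(u in A | u != t) 9 = 9 * m%:R :> K.
  rewrite sumr_const mulr_natr; congr (_ *+ _); move: Am; rewrite (cardsD1 t) tA => -[<-].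
  by apply: eq_card => u; rewrite !inE andbC.
have -> : \sum_(u in A) 8 / m.+1%:R = 8 :> K.
  by rewrite sumr_const Am -[(_ / _) *+ _]mulr_natr mulfVK // pnatr_eq0.
by rewrite mulrC ler_pdivrMr ?ltr0n // -natr1; lra.
Qed.

Lemma ex_prune_size m (st : {set 'I_n} * option 'I_n) (F : nat -> K) : (0 < #|st.1|)%N ->
  ex lt (prune d k m st) (fun st' => F #|st'.1|) = ex lt (size_prune n k m #|st.1|) F.
Proof.
move=> B0; rewrite /prune /size_prune !ex_bind; apply/ex_eq/supp_true => c.
case: ifP => // _; rewrite !ex_bind !ex_draw ?size_iota -?cardE //; congr (_ * _).
rewrite big_enum /= -(sum_rank _ (fun r => F (if (k <= r)%N then r else #|st.1|))).
apply: eq_bigr => v vB; rewrite ex_bind (ex_val _ (supp_compares _ _)) /= loE.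
by rewrite -/(rank lt st.1 v); case: ifP.
Qed.

Lemma ex_size_chainS m (F : nat -> K) :
  ex lt (size_chain n k m.+1) F = ex lt (size_chain n k m) (fun j =>
    ex lt (uniform 0%N (iota 0 m.+1)) (fun r =>
      ex lt (size_prune n k m.+1 (j + (r <= j))%N) F)).
Proof.
rewrite (_ : size_chain n k m.+1 = bind (size_chain n k m) (fun j =>
  bind (uniform 0%N (iota 0 m.+1)) (fun r => size_prune n k m.+1 (j + (r <= j))%N))) //.
by rewrite ex_bind; apply/ex_eq/supp_true => j; rewrite ex_bind.
Qed.

(** By induction the size reached on [A :\ u] has a law independent of [u], so the rank of [u] can
    be averaged as an independent uniform draw. *)
Lemma ex_reduce_size m A (F : nat -> K) : #|A| = m ->
  ex lt (reduce d k m A) (fun st => F #|st.1|) = ex lt (size_chain n k m) F.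
Proof.
elim: m A F => [|m IH] A F Am; first by rewrite /= cards0.
have A0 : (0 < size (enum A))%N by rewrite -cardE Am.
pose G r j := ex lt (size_prune n k m.+1 (j + (r <= j))%N) F.
transitivity (m.+1%:R^-1 * \sum_(u in A) ex lt (size_chain n k m) (G (rank lt A u))); last first.
  rewrite ex_size_chainS -ex_sum -exZ; apply/ex_eq/supp_true => j.
  rewrite ex_draw // size_iota; congr (_ * _).
  by rewrite (sum_rank A (G^~ j)) Am.
have -> : ex lt (reduce d k m.+1 A) (fun st => F #|st.1|) = ex lt (uniform d (enum A)) (fun u =>
    ex lt (bind (reduce d k m (A :\ u)) (fun st => bind (insert u st) (prune d k m.+1)))
       (fun st => F #|st.1|)) by rewrite -ex_bind.
rewrite ex_draw // -cardE Am big_enum /=; congr (_ * _); apply: eq_bigr => u uA.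
have Au : #|A :\ u| = m by move: Am; rewrite (cardsD1 u) uA => -[].
rewrite -(IH _ _ Au) ex_bind; apply: ex_eq; apply: supp_impl (supp_reduce Au) _.
move=> -[B p] rst; have [/= rA pu] := reduced_insert uA rst; have [/= -> _ _] := rst.
rewrite ex_bind (ex_val _ (supp_insert uA (fun q E => proj2 (pu q E)))).
rewrite /G -card_below_insert //; apply: (@ex_prune_size m.+1 (below A p, p)).
by apply: reduced_gt0 rA; rewrite Am.
Qed.

Lemma supp_size_prune m b : supp lt (size_prune n k m b) (fun j => (j <= b)%N).
Proof.
apply/supp_bind/supp_true => c; case: ifP => _; last exact: leqnn.
case: b => [|b]; first by move=> r _ /=; case: ifP; rewrite // nth_nil.
apply: supp_bind; apply: supp_draw => [|r]; first by rewrite size_iota.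
by rewrite mem_iota /= => /ltnW rb; case: ifP.
Qed.

Lemma supp_size_chain m : supp lt (size_chain n k m) (fun j => (j <= m)%N).
Proof.
elim: m => [|m IH] //; apply: supp_bind; apply: supp_impl IH _ => j jm.
apply/supp_bind/supp_true => r.
apply: supp_impl (@supp_size_prune m.+1 (j + (r <= j))%N) _ => i /leq_trans; apply.
by case: (r <= j)%N; rewrite ?addn1 ?ltnS ?addn0 // leqW.
Qed.

Lemma mean_uniform_cut b : (0 < b)%N ->
  ex lt (uniform 0%N (iota 0 b)) (fun r => (if (k <= r)%N then r else b)%:R)
    <= b%:R / 2 + k%:R :> K.
Proof.
move=> b0; have bR : 0 < b%:R :> K by rewrite ltr0n.
rewrite ex_draw ?size_iota // mulrC ler_pdivrMr //.
apply: (@le_trans _ _ (\sum_(r <- iota 0 b) r%:R + \sum_(r <- iota 0 b) (r < k)%N%:R * b%:R)).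
  rewrite -big_split /=; apply: ler_sum => r _; case: ltnP => _.
    by rewrite mul1r lerDr.
  by rewrite mul0r addr0.
rewrite -mulr_suml mulrDl; apply: lerD.
  rewrite -natr_sum -{1}[b]subn0 -/(index_iota 0 b) big_mkord.
  rewrite -mulrA [2^-1 * _]mulrC mulrA ler_pdivlMr // -!natrM ler_nat.
  have := bin2_sum b; rewrite big_mkord => ->; rewrite bin2 -divn2.
  by rewrite (leq_trans (leq_divM _ 2)) // leq_mul2l leq_pred orbT.
by rewrite ler_wpM2r // sum_ltn_iota.
Qed.

(** With probability [4 / m] the mean size drops from [b] to at most [b / 2 + k]. *)
Lemma mean_size_prune m b : (4 <= m)%N ->
  ex lt (size_prune n k m b) (fun j => j%:R) <= b%:R - (2 * b%:R - 4 * k%:R) / m%:R :> K.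
Proof.
move=> m4; have m0 : 0 < m%:R :> K by rewrite ltr0n (leq_trans _ m4).
set X : K := b%:R / 2 + k%:R.
have cutX : ex lt (uniform 0%N (iota 0 b)) (fun r => (if (k <= r)%N then r else b)%:R) <= X.
  case: b @X => [|b] X; last exact: mean_uniform_cut.
  by rewrite /= big_ord1 invr1 mul1r /X mul0r add0r; case: ifP.
rewrite ex_bind ex_draw ?size_iota ?(leq_trans _ m4) // mulrC ler_pdivrMr //.
rewrite -[X in iota 0 X](subnKC m4) iotaD big_cat; apply: (@le_trans _ _ (4 * X + (m - 4)%:R * b%:R)).
  apply: lerD.
    apply: (@le_trans _ _ (\sum_(c <- iota 0 4) X)); last by rewrite !big_cons big_nil; lra.
    rewrite big_seq [leRHS]big_seq; apply: ler_sum => c; rewrite mem_iota => /andP[_ c4].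
    by rewrite c4 ex_bind.
  rewrite big_seq (eq_bigr (fun=> b%:R)) => [|c]; last first.
    by rewrite mem_iota => /andP[c4 _]; rewrite ltnNge c4.
  rewrite -big_seq -[X in \sum_(_ <- iota _ X) _](addKn 4) sumr_const_nat addKn.
  by rewrite mulr_natl.
by rewrite [leRHS]mulrBl divfK ?lt0r_neq0 // natrB // /X; lra.
Qed.

(** At step [M] an insertion adds [(j + 1) / M] on average and pruning removes about
    [(2 * j - 4 * k) / M]; the drift is at most [(1 + 4 * k - j) / M], which vanishes at
    [4 * k + 1]. The first three sizes are at most 3. *)
Lemma mean_size_chain m : ex lt (size_chain n k m) (fun j => j%:R) <= 4 * k%:R + 1 :> K.
Proof.
have k1 : 1 <= k%:R :> K by rewrite ler1n.
elim: m => [|m IH]; first by rewrite /=; lra.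
have [m4|m4] := ltnP m.+1 4.
  rewrite -[leRHS](ex_const lt (size_chain n k m.+1)).
  apply: ex_le; apply: supp_impl (supp_size_chain m.+1) _ => j /(leq_ltn_trans)/(_ m4).
  by rewrite ltnS -(ler_nat K) => j3; lra.
have M0 : 0 < m.+1%:R :> K by rewrite ltr0n.
rewrite ex_size_chainS.
apply: (@le_trans _ _ (ex lt (size_chain n k m) (fun j => (1 + 4 * k%:R) / m.+1%:R + (1 - m.+1%:R^-1) * j%:R))).
  apply: ex_le; apply: supp_impl (supp_size_chain m) _ => j jm.
  apply: (@le_trans _ _ (ex lt (uniform 0%N (iota 0 m.+1)) (fun r =>
     4 * k%:R / m.+1%:R + (1 - 2 / m.+1%:R) * (j + (r <= j))%N%:R))).
    apply/ex_le/supp_true => r; apply: le_trans (mean_size_prune _ m4) _.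
    by apply: eq_imp_le; ring.
  have -> (c1 c2 : K) (X : nat -> K) : ex lt (uniform 0%N (iota 0 m.+1)) (fun r => c1 + c2 * X r)
     = c1 + c2 * ex lt (uniform 0%N (iota 0 m.+1)) X by rewrite exD exZ ex_const.
  apply: (@le_trans _ _ (4 * k%:R / m.+1%:R + (1 - 2 / m.+1%:R) * (j%:R + j.+1%:R / m.+1%:R))).
    rewrite lerD2l ler_wpM2l; first by [].
      by rewrite subr_ge0 ler_pdivrMr // mul1r ler_nat (leq_trans _ m4).
    rewrite ex_draw size_iota // mulrC ler_pdivrMr // mulrDl mulfVK ?lt0r_neq0 //.
    under eq_bigr do rewrite natrD.
    rewrite big_split big_const_seq count_predT size_iota iter_addr_0 mulr_natr lerD2l.
    by under eq_bigr do rewrite -ltnS; apply: sum_ltn_iota.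
  have jmR : j%:R + 1 <= m.+1%:R :> K by rewrite natr1 ler_nat.
  rewrite -(ler_pM2r M0) -(ler_pM2r M0) -[j.+1%:R]natr1.
  move: (m.+1%:R) (j%:R) (ler0n K j) M0 jmR => M J J0 M0 jmR.
  have -> : (4 * k%:R / M + (1 - 2 / M) * (J + (J + 1) / M)) * M * M = 4 * k%:R * M + (M - 2) * (J * M + J + 1).
    by field; rewrite lt0r_neq0.
  have -> : ((1 + 4 * k%:R) / M + (1 - M^-1) * J) * M * M = (1 + 4 * k%:R) * M + (M - 1) * J * M.
    by field; rewrite lt0r_neq0.
  (* The two sides differ by [2 * (J + 1)]. *)
  nra.
rewrite exD ex_const exZ.
have Mi : m.+1%:R^-1 <= 1 :> K by rewrite invf_le1 // ler1n.
apply: (@le_trans _ _ ((1 + 4 * k%:R) / m.+1%:R + (1 - m.+1%:R^-1) * (4 * k%:R + 1))).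
  by rewrite lerD2l ler_wpM2l // subr_ge0.
by apply: eq_imp_le; ring.
Qed.

End ReductionAnalysis.

(** * The potential ln ln *)

Bind Scope ring_scope with R.

Definition root6 b := (\max_(i < b.+1 | i ^ 6 <= b) i)%N.

Lemma root6_le b : (root6 b ^ 6 <= b)%N.
Proof.
rewrite /root6; elim/big_ind: _ => // x y xb yb.
by case: (leqP x y).
Qed.

Lemma root6_gt b : (b < (root6 b).+1 ^ 6)%N.
Proof.
rewrite ltnNge; apply/negP => H.
have rb : ((root6 b).+1 < b.+1)%N.
  by rewrite ltnS (leq_trans _ H) // -[X in (X <= _)%N]expn1 leq_pexp2l.
by have := @leq_bigmax_cond _ (fun i : 'I_b.+1 => i ^ 6 <= b)%N (@nat_of_ord _) (Ordinal rb) H; rewrite ltnn.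
Qed.

(** This is [1 + w <= exp w] at [w = ln (u / v)]. *)
Lemma ln_tangent (u v : R) : 0 < u -> 0 < v -> ln u <= ln v + (u - v) / v.
Proof.
move=> u0 v0; have /RleP := exp_ineq1_le (ln (u / v)%R).
rewrite exp_ln; last by apply/RltP; rewrite divr_gt0.
have -> : ln (u / v)%R = ln u - ln v.
  rewrite -[- _]ln_Rinv; last exact/RltP.
  by apply: ln_mult; apply/RltP => //; rewrite invr_gt0.
rewrite RplusE R1E mulrBl divff ?lt0r_neq0 // => H.
by rewrite -lerBlDl lerBrDl.
Qed.

Lemma ln_le_mono (u v : R) : 0 < u -> u <= v -> ln u <= ln v.
Proof. by move=> /RltP u0 /RleP uv; apply/RleP; case: uv => [uv|->]; [left; apply: ln_increasing|right]. Qed.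

Lemma ln_natpow (x : R) m : 0 < x -> ln (x ^+ m)%R = m%:R * ln x.
Proof. by move=> /RltP x0; rewrite -RpowE ln_pow // INRE. Qed.

Lemma ln1 : ln 1 = 0 :> R.
Proof. exact: ln_1. Qed.

(** The shift by 3, which exceeds e, makes the inner logarithm at least 1 and the potential
    nonnegative. *)
Definition lnln (x : R) : R := ln (ln (x + 3)%R)%R.

Lemma ln_gt0 (x : R) : 1 < x -> 0 < ln x.
Proof. by move=> /RltP x1; apply/RltP; rewrite -ln1; apply: ln_increasing => //; apply/RltP. Qed.

(* Jensen's inequality for [lnln], from the tangents of [ln]. *)
Lemma lnln_mean n lt a (p : prog n a) (F : a -> nat) (z : R) :
  1 < z -> ex lt p (fun v => (F v)%:R) + 3 <= z ->
  ex lt p (fun v => lnln (F v)%:R) <= ln (ln z)%R.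
Proof.
move=> z1 Fz; have z0 : 0 < z by lra.
have lz := ln_gt0 z1.
apply: (@le_trans _ _ (ex lt p (fun v => ln (ln z)%R + ((3 - z) / z / ln z + (z^-1 / ln z) * (F v)%:R)))).
  apply/ex_le/supp_true => v; rewrite /lnln.
  have F3 : 1 < (F v)%:R + 3 :> R by rewrite (@lt_le_trans _ _ 3) ?lerDr //; lra.
  apply: le_trans (ln_tangent (ln_gt0 F3) lz) _; rewrite lerD2l.
  have -> : (3 - z) / z / ln z + z^-1 / ln z * (F v)%:R = ((F v)%:R + 3 - z) / z / ln z.
    by field; rewrite !lt0r_neq0.
  rewrite ler_pM2r ?invr_gt0 // lerBlDl; apply: ln_tangent => //; lra.
rewrite !exD !ex_const exZ gerDl; set E := ex _ _ _ in Fz *.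
have -> : (3 - z) / z / ln z + z^-1 / ln z * E = - ((z - (E + 3)) / z / ln z).
  by field; rewrite !lt0r_neq0.
by rewrite oppr_le0; apply: divr_ge0 (ltW lz); apply: divr_ge0 (ltW z0); rewrite subr_ge0.
Qed.

Lemma ln3_ge1 (x : R) : 3 <= x -> 1 <= ln x.
Proof.
move=> x3; have -> : 1 = ln (exp 1)%R by rewrite ln_exp.
apply: ln_le_mono; first by apply/RltP/exp_pos.
apply: le_trans x3; have /RleP := exp_le_3.
by rewrite IZRposE INRE.
Qed.

Lemma lnln_ge0 (x : R) : 0 <= x -> 0 <= lnln x.
Proof.
move=> x0; rewrite /lnln -ln1; apply: ln_le_mono => //.
by apply: ln3_ge1; rewrite lerDr.
Qed.

(** The new size is about [b ^ (5/6)]; weakening the exponent to [11/12] absorbs the factor 16, and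
    [ln (11/12) <= - 1/12]. *)
Lemma lnln_shrink (b m : nat) : (257 <= m)%N -> (m ^ 6 <= b)%N -> (b < m.+1 ^ 6)%N ->
  ln (ln (16 * b%:R / m%:R)%R)%R <= lnln b%:R - 12^-1.
Proof.
move=> m257 mb bm.
have m0 : 0 < m%:R :> R by rewrite ltr0n (leq_trans _ m257).
have mb1 : (m <= b)%N by rewrite (leq_trans _ mb) // -[X in (X <= _)%N]expn1 leq_pexp2l // (leq_trans _ m257).
have b1 : 1 <= b%:R :> R by rewrite ler1n (leq_trans _ mb1) // (leq_trans _ m257).
have b0 : 0 < b%:R :> R by lra.
set z := 16 * b%:R / m%:R.
have z1 : 1 < z by rewrite ltr_pdivlMr // mul1r (@le_lt_trans _ _ b%:R) ?ler_nat //; lra.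
have z0 : 0 < z by lra.
have zb : ln z <= 11 / 12 * ln (b%:R + 3)%R.
  have : ln (z ^+ 12)%R <= ln (b%:R ^+ 11)%R.
    apply: ln_le_mono; first by rewrite exprn_gt0.
    (* Since [16 ^ 12 = 256 ^ 6] and [b < (m + 1) ^ 6], it suffices that
       [256 * (m + 1) <= m ^ 2]. *)
    have -> : z ^+ 12 = (256 ^+ 6 * b%:R) * b%:R ^+ 11 / m%:R ^+ 12 by rewrite /z; field; rewrite lt0r_neq0.
    rewrite ler_pdivrMr ?exprn_gt0 // mulrC ler_wpM2l ?exprn_ge0 //.
    apply: (@le_trans _ _ ((256 * m.+1%:R) ^+ 6)).
      by rewrite exprMn ler_wpM2l ?exprn_ge0 // -natrX ler_nat ltnW.
    have -> : m%:R ^+ 12 = (m%:R ^+ 2) ^+ 6 :> R by rewrite -exprM.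
    have m257R : 257 <= m%:R :> R by rewrite ler_nat.
    by rewrite lerXn2r ?nnegrE ?mulr_ge0 ?exprn_ge0 // -natr1; nra.
  rewrite !ln_natpow //; have : ln b%:R <= ln (b%:R + 3)%R by apply: ln_le_mono => //; lra.
  by lra.
have lb : 0 < ln (b%:R + 3)%R by apply: ln_gt0; lra.
apply: le_trans (ln_le_mono (ln_gt0 z1) zb) _.
have -> : ln (11 / 12 * ln (b%:R + 3)%R)%R = ln (11 / 12)%R + lnln b%:R.
  have c0 : 0 < 11 / 12 :> R by lra.
  by apply: ln_mult; apply/RltP.
have : ln (11 / 12)%R <= ln 1 + (11 / 12 - 1) / 1 by apply: ln_tangent; lra.
by rewrite ln1; lra.
Qed.

(** * The selection algorithm *)

(* 257 is the least [m] such that [256 * (m + 1) <= m ^ 2], which is what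
   [lnln_shrink] needs. *)
Fixpoint select n (d : 'I_n) fuel (st : {set 'I_n} * nat) : prog n 'I_n :=
  let m := root6 #|st.1| in
  if fuel is fuel'.+1 then
    if (m < 257)%N then naive_select d st.1 st.2
    else bind (round d m st) (select d fuel')
  else naive_select d st.1 st.2.

(** Ranks start at 0, hence [k.-1]; the reduction discards only elements above x_k and so preserves
    its rank. *)
Definition kth n (d : 'I_n) k : prog n 'I_n :=
  bind (reduce d k n setT) (fun st => select d n (st.1, k.-1)).

(** * Correctness and cost of the whole algorithm *)

Section SelectAnalysis.
Variables (n : nat) (d : 'I_n) (key : 'I_n -> nat).
Hypothesis key_inj : injective key.
Notation lt := (relpre key ltn).

(** Exhausted fuel falls back on exhaustive comparison, so fuel matters only for the cost. *)
Lemma supp_select fuel (B : {set 'I_n}) t : t \in B ->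
  supp lt (select d fuel (B, rank lt B t)) (eq t).
Proof.
elim: fuel B => [|fuel IH] B tB; first exact: supp_naive_select.
rewrite /select -/select; case: ltnP => m257; first exact: supp_naive_select.
apply: supp_bind; apply: supp_impl (@supp_round _ d _ key_inj _ _ _ tB) _.
by move=> [B' r] [/= tB' -> _]; apply: IH.
Qed.

(** A round costs at most 8 and lowers the mean potential by [1/12], hence the factor 96. Below the
    threshold the set has fewer than [257 ^ 6] elements. Fuel suffices because each round shrinks
    the set. *)
Lemma cost_select fuel (B : {set 'I_n}) t : (#|B| <= fuel)%N -> t \in B ->
  cost lt t (select d fuel (B, rank lt B t)) <= 2 * 257%:R ^+ 6 + 96 * lnln #|B|%:R :> R.
Proof.
elim: fuel B => [|fuel IH] B Bf tB.
  by have : (0 < #|B|)%N by [apply/card_gt0P; exists t]; rewrite ltnNge Bf.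
have mb := root6_le #|B|; have bm := root6_gt #|B|.
rewrite /select -/select; set m := root6 #|B| in mb bm *; case: ltnP => m257.
  apply: le_trans (cost_naive_select _ _ _ _ _ _) _.
  rewrite -[leLHS]addr0; apply: lerD; last by rewrite mulr_ge0 ?lnln_ge0.
  rewrite ler_wpM2l // -natrX ler_nat (leq_trans (ltnW bm)) //.
  by rewrite leq_exp2r.
have m0 : (0 < m)%N by apply: leq_trans m257.
have mb1 : (m <= #|B|)%N by rewrite (leq_trans _ mb) // -[X in (X <= _)%N]expn1 leq_pexp2l.
have mb3 : (m ^ 3 <= #|B|)%N by rewrite (leq_trans _ mb) // leq_pexp2l.
have m0R : 0 < m%:R :> R by rewrite ltr0n.
have mbR : 1 <= #|B|%:R / m%:R :> R by rewrite ler_pdivlMr // mul1r ler_nat.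
rewrite cost_bind.
apply: (@le_trans _ _ (8 + ex lt (round d m (B, rank lt B t))
    (fun st => 2 * 257%:R ^+ 6 + 96 * lnln #|st.1|%:R))).
  apply: lerD; first exact: cost_round.
  apply: ex_le; apply: supp_impl (@supp_round _ d _ key_inj _ _ _ tB) _ => -[B' r] [/= tB' -> lt1].
  apply: IH => //; rewrite -ltnS (leq_trans _ Bf) // lt1 //.
  by apply: leq_trans mb1; apply: leq_trans m257.
rewrite exD ex_const exZ addrCA lerD2l.
have := mean_size_round R d key_inj tB m0 mb3; rewrite -mulrA => size_le.
(* The mean size plus 3 is at most [4 + 12 * b / m], hence at most [16 * b / m] as [m <= b]. *)
have z1 : 1 < 16 * #|B|%:R / m%:R :> R by rewrite -mulrA; lra.
have := @lnln_mean _ lt _ (round d m (B, rank lt B t)) (fun st => #|st.1|) _ z1.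
rewrite -{1}mulrA => /(_ ltac:(lra)) /le_trans /(_ (lnln_shrink m257 mb bm)).
by lra.
Qed.

Lemma reduced_rank (k : nat) (A : {set 'I_n}) st t : t \in A -> (rank lt A t < k)%N ->
  reduced k key A st -> t \in st.1 /\ rank lt st.1 t = rank lt A t.
Proof.
move=> tA tk [-> _ H].
have tp : t \in below key A st.2.
  rewrite inE tA; case: st.2 H => [q /(_ q erefl)[qA kq]|_] //=.
  rewrite ltnNge; apply/negP => qt; move: tk; rewrite ltnNge => /negP; apply.
  apply: leq_trans kq _; apply/subset_leq_card/subsetP => y.
  by rewrite !inE /= => /andP[-> yq]; apply: leq_trans yq qt.
split=> //; apply: eq_card => y; rewrite !inE /=.
case: (y \in A) => //=; case: ltnP => yt; rewrite ?andbF ?andbT //.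
move: tp; rewrite inE => /andP[_]; case: st.2 {H} => [q|] //=.
exact: ltn_trans.
Qed.

Lemma supp_kth k t : (0 < k)%N -> rank lt setT t = k.-1 -> supp lt (kth d k) (eq t).
Proof.
move=> k0 tk; have En : #|[set: 'I_n]| = n by rewrite cardsT card_ord.
apply: supp_bind; apply: supp_impl (@supp_reduce _ d _ _ k0 _ _ En) _ => st rst.
have [|tst trank] := reduced_rank (in_setT t) _ rst; first by rewrite tk ltn_predL.
by rewrite -tk -trank; apply: supp_select.
Qed.

(** Jensen's inequality at mean size [4 * k + 1], with [4 * k + 4 <= (k + 2) ^ 3] and [ln 3 <= 2],
    gives the constant [201 = 9 + 96 * 2]. *)
Lemma cost_kth k t : (0 < k)%N -> rank lt setT t = k.-1 ->
  cost lt t (kth d k) <= (201 + 2 * 257%:R ^+ 6) * (1 + ln (ln (k%:R + 2)%R)) :> R.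
Proof.
move=> k0 tk; have En : #|[set: 'I_n]| = n by rewrite cardsT card_ord.
have tlt : (rank lt setT t < k)%N by rewrite tk ltn_predL.
have k1 : 1 <= k%:R :> R by rewrite ler1n.
rewrite cost_bind.
apply: (@le_trans _ _ (9 + ex lt (reduce d k n setT) (fun st => 2 * 257%:R ^+ 6 + 96 * lnln #|st.1|%:R))).
  apply: lerD; first exact: (proj2 (cost_reduce R d key k0 t En) (in_setT t) tlt).
  apply: ex_le; apply: supp_impl (@supp_reduce _ d _ _ k0 _ _ En) _ => st rst.
  have [tst trank] := reduced_rank (in_setT t) tlt rst.
  rewrite -tk -trank; apply: cost_select => //.
  by rewrite -[X in (_ <= X)%N]En subset_leq_card // subsetT.
rewrite exD ex_const exZ.
have z1 : 1 < 4 * k%:R + 4 :> R by lra.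
have := @lnln_mean _ lt _ (reduce d k n setT) (fun st => #|st.1|) _ z1.
have -> := ex_reduce_size d key_inj k0 (fun j => j%:R : R) En.
have := mean_size_chain R key k0 n => mean /(_ ltac:(lra)).
have l2 : 1 <= ln (k%:R + 2)%R by apply: ln3_ge1; lra.
have : ln (4 * k%:R + 4)%R <= 3 * ln (k%:R + 2)%R.
  by rewrite -(ln_natpow 3) ?ltr_wpDl //; apply: ln_le_mono; [lra|nra].
move=> /(ln_le_mono (ln_gt0 z1)); have -> : ln (3 * ln (k%:R + 2)%R)%R = ln 3 + ln (ln (k%:R + 2)%R).
  have h3 : 0 < 3 :> R by []; have h : 0 < ln (k%:R + 2)%R by lra.
  by apply: ln_mult; apply/RltP.
have : ln 3 <= ln 1 + (3 - 1) / 1 by apply: ln_tangent.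
have l0 : 0 <= ln (ln (k%:R + 2)%R) by rewrite -ln1; apply: ln_le_mono.
have C0 : 0 <= 257%:R ^+ 6 :> R by rewrite exprn_ge0.
rewrite ln1; set E := ex _ _ _; move: (257%:R ^+ 6) C0 => C C0.
by nra.
Qed.

End SelectAnalysis.

(** * Transfer to algorithms on histories and arbitrary ordered keys *)

Theorem theorem4 :
  exists (C : R), exists (A : forall n k : nat, algorithm n),
  forall (n k : nat), (1 <= k)%nat -> (k <= n)%nat ->
  forall (d : Order.disp_t) (T : orderType d) (x : 'I_n -> T),
  injective x ->
  forall t : 'I_n, is_kth x k t ->
    (* Las Vegas: returns the position of x_k with probability 1 *)
    (forall eps : R, Rlt 0 eps ->
       exists fuel : nat,
         Rle (Rminus 1 eps) (prob_returns (A n k) (cmp_oracle x) t fuel [::]))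
    /\
    (* expected number of comparisons in which x_k participates is O(log log k) *)
    (forall fuel : nat,
       Rle (exp_part_cost (A n k) (cmp_oracle x) t fuel [::])
           (Rmult C (Rplus 1 (ln (ln (Rplus (INR k) 2)))))).
Proof.
exists (201 + 2 * 257%:R ^+ 6).
(* For [n = 0] there is no position to return, so any action serves. *)
exists (fun n k => if n is n'.+1 then run (kth (ord0 : 'I_n'.+1) k) else fun=> Rand 0).
move=> [|n] k k0 kn d T x x_inj t tk; first by case: t tk.
(* Ranks are natural-number keys with the same comparisons as [x]. *)
pose key i := #|[pred j : 'I_n.+1 | Order.lt (x j) (x i)]|.
have keyE i j : (key i < key j)%N = Order.lt (x i) (x j).
  apply/idP/idP => [|ij].
    apply: contraLR; rewrite -leNgt -leqNgt => ji.
    by apply/subset_leq_card/subsetP => u; rewrite !inE => /lt_le_trans; apply.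
  apply/proper_card/properP; split.
    by apply/subsetP => u; rewrite !inE => /lt_trans; apply.
  by exists i; rewrite !inE ?ij ?ltxx.
have key_inj : injective key.
  move=> i j ij; apply: x_inj; case: (ltgtP (x i) (x j)) => //; rewrite -keyE ij ltnn //.
have rk : rank (relpre key ltn) setT t = k.-1.
  by rewrite -tk; apply: eq_card => u; rewrite !inE /= keyE.
have ans i j : cmp_oracle x i j = relpre key ltn i j by rewrite /= keyE.
split=> [eps /RltP eps0|fuel].
  (* The tree is finite, so one fuel, independent of [eps], gives probability exactly 1. *)
  exists (depth (kth (ord0 : 'I_n.+1) k)).
  rewrite (run_returns ans (p := kth ord0 k)) //; last exact: supp_kth.
  by apply/RleP; rewrite gerBl ltW.
apply/RleP; apply: le_trans (run_cost _ _ ans (p := kth ord0 k) _) _ => //.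
by have H := cost_kth ord0 key_inj k0 rk; rewrite -(INRE k) in H; exact: H.
Qed.
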